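(* Let $(\mathcal{P},\{\,,\}_1,\bullet_1)$ be a finite-dimensional Poisson superalgebra over $\mathbb{K}$ equipped with two even linear maps $\delta,\Delta:\mathcal{P}\to\mathcal{P}\otimes\mathcal{P}$. Suppose that the dual maps $\delta^*,\Delta^*:\mathcal{P}^*\otimes\mathcal{P}^*\to\mathcal{P}^*$ define a Poisson superalgebra structure $(\mathcal{P}^*,\{\,,\}_2,\bullet_2)$ on $\mathcal{P}^*$, where $\{\,,\}_2=\delta^*$ is the Lie bracket and $\bullet_2=\Delta^*$ is the commutative associative product. Let $\delta',\Delta':\mathcal{P}^*\to\mathcal{P}^*\otimes\mathcal{P}^*$ be the comultiplications dual to $\{\,,\}_1$ and $\bullet_1$. Then the following conditions are equivalent: 1. $(\mathcal{P},\{\,,\}_1,\bullet_1,\delta,\Delta)$ and $(\mathcal{P}^*,\{\,,\}_2,\bullet_2,\delta',\Delta')$ are Poisson superbialgebras. 2. $(\mathcal{P},\mathcal{P}^*,ad^*_{\{,\}_1},-L^*_{\bullet_1},ad^*_{\{,\}_2},-L^*_{\bullet_2})$ is a matched pair of Poisson superalgebras. 3. $(\mathcal{P}\oplus\mathcal{P}^*,\mathcal{P},\mathcal{P}^* )$ is a standard Manin triple of Poisson superalgebras, i.e. there is a Poisson superalgebra structure on $\mathcal{P}\oplus\mathcal{P}^*$ containing $(\mathcal{P},\{\,,\}_1,\bullet_1)$ and $(\mathcal{P}^*,\{\,,\}_2,\bullet_2)$ as Poisson sub-superalgebras, which are isotropic for the bilinear form $B_p(x+a,y+b)=\langle x,b\rangle+\langle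 a,y\rangle$ ($x,y\in\mathcal{P}$, $a,b\in\mathcal{P}^*$), and for which $B_p$ is invariant.
   Context: $\mathbb{K}$ is a field of characteristic $0$; $|x|\in\mathbb{Z}_2$ is the parity of a homogeneous element; all identities are for homogeneous elements; $\tau(x\otimes y)=(-1)^{|x||y|}y\otimes x$ and $\xi(x\otimes y\otimes z)=(-1)^{|x|(|y|+|z|)}y\otimes z\otimes x$. Pairings. $\langle a,x\rangle=a(x)$ for $a\in\mathcal{P}^*$, $x\in\mathcal{P}$; $\langle x,a\rangle=(-1)^{|x||a|}\langle a,x\rangle$; $\langle x_1\otimes x_2,a\otimes b\rangle=(-1)^{|x_2||a|}\langle x_1,a\rangle\langle x_2,b\rangle$ and $\langle a\otimes b,x_1\otimes x_2\rangle=(-1)^{|b||x_1|}\langle a,x_1\rangle\langle b,x_2\rangle$. Dual operations: $\langle x,\{a,b\}_2\rangle=\langle\delta(x),a\otimes b\rangle$, $\langle x,a\bullet_2b\rangle=\langle\Delta(x),a\otimes b\rangle$, $\langle\delta'(a),x\otimes y\rangle=\langle a,\{x,y\}_1\rangle$, $\langle\Delta'(a),x\otimes y\rangle=\langle a,x\bullet_1y\rangle$. $\mathcal{P}$ is identified with $\mathcal{P}^{**}$ through $\langle x,a\rangle$. Poisson superalgebra $(\mathcal{P},\{\,,\},\bullet)$: a $\mathbb{Z}_2$-graded vector space with even bilinear maps such that (i) $\{x,y\}=-(-1)^{|x||y|}\{y,x\}$ and $(-1)^{|x||z|}\{x,\{y,z\}\}+(-1)^{|z||y|}\{z,\{x,y\}\}+(-1)^{|y||x|}\{y,\{z,x\}\}=0$;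 (ii) $x\bullet y=(-1)^{|x||y|}y\bullet x$, $x\bullet(y\bullet z)=(x\bullet y)\bullet z$; (iii) $\{x,y\bullet z\}=\{x,y\}\bullet z+(-1)^{|x||y|}y\bullet\{x,z\}$. Poisson superbialgebra $(\mathcal{A},\{\,,\},\bullet,\delta,\Delta)$: $(\mathcal{A},\{\,,\},\bullet)$ is a Poisson superalgebra and $\delta,\Delta:\mathcal{A}\to\mathcal{A}\otimes\mathcal{A}$ are even linear maps, written $\delta(x)=\sum x_{[1]}\otimes x_{[2]}$, $\Delta(x)=\sum x_{(1)}\otimes x_{(2)}$, such that: (a) $\tau\delta=-\delta$ and $(id+\xi+\xi^2)(id\otimes\delta)\delta=0$ (Lie supercoalgebra); (b) $\tau\Delta=\Delta$ and $(id\otimes\Delta)\Delta=(\Delta\otimes id)\Delta$; (c) $(id\otimes\Delta)\delta=(\delta\otimes id)\Delta+(\tau\otimes id)(id\otimes\delta)\Delta$; (d) $\delta(\{x,y\})=ad(x)\delta(y)-(-1)^{|x||y|}ad(y)\delta(x)$, where $ad(x)(y_1\otimes y_2)=\{x,y_1\}\otimes y_2+(-1)^{|x||y_1|}y_1\otimes\{x,y_2\}$; (e) $\Delta(x\bullet y)=\sum (x\bullet y_{(1)})\otimes y_{(2)}+\sum x_{(1)}\otimes(x_{(2)}\bullet y)$; (f) $\delta(x\bullet y)=(-1)^{|x||y|}\sum(y\bullet x_{[1]})\otimes x_{[2]}+\sum(x\bullet y_{[1]})\otimes y_{[2]}+\sum(-1)^{|x||y_{(1)}|}y_{(1)}\otimes\{x,y_{(2)}\}+\sum(-1)^{|x||y|+|y||x_{(1)}|}x_{(1)}\otimes\{y,x_{(2)}\}$;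 (g) $\Delta(\{x,y\})=\sum\{x,y_{(1)}\}\otimes y_{(2)}+\sum(-1)^{|x||y_{(1)}|}y_{(1)}\otimes\{x,y_{(2)}\}+(-1)^{|x||y|}\sum\big((y\bullet x_{[1]})\otimes x_{[2]}-(-1)^{|y||x_{[1]}|}x_{[1]}\otimes(y\bullet x_{[2]})\big)$. Coadjoint maps: with $ad_{\{,\}_i}(u)v=\{u,v\}_i$ and $L_{\bullet_i}(u)v=u\bullet_iv$, for $x,y\in\mathcal{P}$, $a,b\in\mathcal{P}^*$: $\langle ad^*_{\{,\}_1}(x)a,y\rangle=-(-1)^{|x||a|}\langle a,\{x,y\}_1\rangle$, $\langle L^*_{\bullet_1}(x)a,y\rangle=-(-1)^{|x||a|}\langle a,x\bullet_1y\rangle$, $\langle ad^*_{\{,\}_2}(a)x,b\rangle=-(-1)^{|a||x|}\langle x,\{a,b\}_2\rangle$, $\langle L^*_{\bullet_2}(a)x,b\rangle=-(-1)^{|a||x|}\langle x,a\bullet_2b\rangle$. Matched pair of Poisson superalgebras $(\mathcal{P}_1,\mathcal{P}_2,\rho_1,\varphi_1,\rho_2,\varphi_2)$: $\mathcal{P}_1,\mathcal{P}_2$ are Poisson superalgebras and $\rho_1,\varphi_1:\mathcal{P}_1\to End(\mathcal{P}_2)$, $\rho_2,\varphi_2:\mathcal{P}_2\to End(\mathcal{P}_1)$ are even linear maps such that, for homogeneous $x,y\in\mathcal{P}_1$, $a,b\in\mathcal{P}_2$, the following conditions (R), (M1), (M2), (M3) hold, together with those obtained from them by exchanging the roles of $(\mathcal{P}_1,\rho_1,\varphi_1)$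 and $(\mathcal{P}_2,\rho_2,\varphi_2)$: (R) $(\mathcal{P}_2,\rho_1,\varphi_1)$ is a representation of $\mathcal{P}_1$: $\rho_1(\{x,y\}_1)=\rho_1(x)\rho_1(y)-(-1)^{|x||y|}\rho_1(y)\rho_1(x)$, $\varphi_1(x\bullet_1y)=\varphi_1(x)\varphi_1(y)$, $\rho_1(x\bullet_1y)=\varphi_1(x)\rho_1(y)+(-1)^{|x||y|}\varphi_1(y)\rho_1(x)$, $\varphi_1(\{x,y\}_1)=\rho_1(x)\varphi_1(y)-(-1)^{|x||y|}\varphi_1(y)\rho_1(x)$; (M1) $\rho_2(a)\{x,y\}_1=\{\rho_2(a)x,y\}_1+(-1)^{|x||a|}\{x,\rho_2(a)y\}_1+(-1)^{|x||y|+|y||a|}\rho_2(\rho_1(y)a)x-(-1)^{|x||a|}\rho_2(\rho_1(x)a)y$; (M2) $\varphi_2(a)(x\bullet_1y)=(\varphi_2(a)x)\bullet_1y+(-1)^{|x||a|}\varphi_2(\varphi_1(x)a)y$; (M3) $\rho_2(a)(x\bullet_1y)=(\rho_2(a)x)\bullet_1y+(-1)^{|a||x|}x\bullet_1(\rho_2(a)y)-(-1)^{|a||x|}\varphi_2(\rho_1(x)a)y-(-1)^{|a||y|+|x||y|}\varphi_2(\rho_1(y)a)x$ and $\{x,\varphi_2(a)y\}_1-(-1)^{|x||a|+|x||y|+|a||y|}\rho_2(\varphi_1(y)a)x=\varphi_2(\rho_1(x)a)y-(-1)^{|x||a|}(\rho_2(a)x)\bullet_1y+(-1)^{|x||a|}\varphi_2(a)(\{x,y\}_1)$.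 A bilinear form $B$ on a Poisson superalgebra is invariant if $B(\{u,v\},w)=B(u,\{v,w\})$ and $B(u\bullet v,w)=B(u,v\bullet w)$; a subspace is isotropic if $B$ vanishes on it. *)

(* Defs.v *)
From HB Require Import structures.
From mathcomp Require Import all_boot all_order all_algebra.

Set Implicit Arguments.
Unset Strict Implicit.
Unset Printing Implicit Defensive.

Import GRing.Theory.
Local Open Scope ring_scope.

Reserved Notation "u '\ox' v" (at level 40, left associativity).

HB.mixin Record Vector_isSuper (K : fieldType) V of Vector K V := {
  gr : bool -> {vspace V};
  gr_full : (gr false + gr true = fullv)%VS;
  gr_direct : (gr false :&: gr true = 0)%VS
}.

#[short(type="superVectType")]
HB.structure Definition SuperVect (K : fieldType) :=
  {V of Vector K V & Vector_isSuper K V}.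

Definition bilin (K : fieldType) (U V W : vectType K) (f : U -> V -> W) : Prop :=
  (forall v, linear (f^~ v)) /\ (forall u, linear (f u)).

Section Linear.
Variables (K : fieldType) (V W : vectType K) (f : V -> W).
Hypothesis fL : linear f.

Let f0 : f 0 = 0.
Proof. by have := fL (-1) 0 0; rewrite !scaleN1r !addNr. Qed.

Lemma linear_sumZ I (r : seq I) (c : I -> K) (F : I -> V) :
  f (\sum_(i <- r) c i *: F i) = \sum_(i <- r) c i *: f (F i).
Proof.
elim: r => [|i r IH]; first by rewrite !big_nil.
by rewrite !big_cons fL IH.
Qed.

Lemma linfunE : linfun f =1 f.
Proof.
move=> x; pose fM := GRing.isLinear.Build K V W _ f fL.
pose ff : {linear V -> W} := HB.pack f fM.
exact: (lfunE ff x).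
Qed.

End Linear.

Lemma linfun2E (K : fieldType) (U V W : vectType K) (f : U -> V -> W) :
  bilin f -> forall u v, linfun (fun u => linfun (f u)) u v = f u v.
Proof.
move=> [fl fr] u v; rewrite linfunE ?(linfunE (fr _)) // => c x y.
by apply/lfunP=> w; rewrite add_lfunE scale_lfunE !(linfunE (fr _)) fl.
Qed.

Section Tensor.
Variables (K : fieldType) (U V : vectType K).

(* Coordinates on the tensor products of the vectors of the chosen bases. *)
Definition tensor : Type := 'M[K]_(\dim {:U}, \dim {:V}).
HB.instance Definition _ := Vector.on tensor.

Definition tens (u : U) (v : V) : tensor :=
  \matrix_(i, j) (coord (vbasis fullv) i u * coord (vbasis fullv) j v).

(* The linear map sending u \ox v to f u v when f is bilinear. *)
Definition tlift (W : vectType K) (f : U -> V -> W) : 'Hom(tensor, W) :=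
  linfun (fun t : tensor => \sum_i \sum_j
    t i j *: f (vbasis fullv)`_i (vbasis fullv)`_j).

End Tensor.

Notation "u '\ox' v" := (tens u v) : ring_scope.

Section TensorTheory.
Variables (K : fieldType) (U V W : vectType K).
Implicit Types (u : U) (v : V) (t : tensor U V).

Lemma tens_bilin : bilin (@tens K U V).
Proof.
split=> [v c u u'|u c v v']; apply/matrixP=> i j; rewrite !mxE linearP /=.
  by rewrite mulrDl mulrA.
by rewrite mulrDr mulrCA.
Qed.

Lemma tlift_sum (f : U -> V -> W) t :
  tlift f t = \sum_i \sum_j t i j *: f (vbasis fullv)`_i (vbasis fullv)`_j.
Proof.
rewrite /tlift linfunE // => c {}t t'.
rewrite scaler_sumr -big_split; apply: eq_bigr => i _ /=.
rewrite scaler_sumr -big_split; apply: eq_bigr => j _ /=.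
by rewrite !mxE scalerDl scalerA.
Qed.

Lemma tliftE (f : U -> V -> W) : bilin f -> forall u v, tlift f (u \ox v) = f u v.
Proof.
move=> [fl fr] u v; rewrite tlift_sum.
rewrite [in RHS](coord_vbasis (memvf u)) (linear_sumZ (fl v)).
apply: eq_bigr => i _.
rewrite [in RHS](coord_vbasis (memvf v)) (linear_sumZ (fr _)) scaler_sumr.
by apply: eq_bigr => j _; rewrite mxE scalerA.
Qed.

Lemma tensE t :
  t = \sum_i \sum_j t i j *: ((vbasis fullv)`_i \ox (vbasis fullv)`_j).
Proof.
apply/matrixP=> a b; rewrite summxE (bigD1 a) //= summxE (bigD1 b) //=.
have fU := basis_free (vbasisP {:U}); have fV := basis_free (vbasisP {:V}).
rewrite !mxE !coord_free // !eqxx !mulr1 !big1 ?addr0 //.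
  move=> i ia; rewrite summxE big1 // => j _.
  by rewrite !mxE !coord_free // (negPf ia) mul0r mulr0.
by move=> j jb; rewrite !mxE !coord_free // (negPf jb) !mulr0.
Qed.

Lemma tens_ext (f g : 'Hom(tensor U V, W)) :
  (forall u v, f (u \ox v) = g (u \ox v)) -> f = g.
Proof.
move=> fg; apply/lfunP=> t; rewrite (tensE t) !linear_sum.
apply: eq_bigr => i _; rewrite !linear_sum; apply: eq_bigr => j _.
by rewrite !linearZ /= fg.
Qed.

End TensorTheory.

Section Homogeneous.
Variables (K : fieldType) (V : superVectType K).
Implicit Types v : V.

Definition hpart (i : bool) : 'End(V) := daddv_pi (gr i) (gr (~~ i)).

Lemma gr_disj i : (gr i :&: gr (~~ i) = 0 :> {vspace V})%VS.
Proof. by case: i; rewrite ?gr_direct // capvC gr_direct. Qed.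

Lemma gr_add i : (gr i + gr (~~ i) = fullv :> {vspace V})%VS.
Proof. by case: i; rewrite ?gr_full // addvC gr_full. Qed.

Lemma hpart_gr i v : hpart i v \in gr i.
Proof. exact: memv_pi. Qed.

Lemma hpart_add i v : hpart i v + hpart (~~ i) v = v.
Proof.
rewrite /hpart negbK daddv_pi_add ?gr_disj // gr_add; exact: memvf.
Qed.

Lemma hpart_sum v : \sum_i hpart i v = v.
Proof. by rewrite big_bool /= (hpart_add true). Qed.

Lemma hpart_id i v : v \in gr i -> hpart i v = v.
Proof. by move=> vi; rewrite /hpart daddv_pi_id ?gr_disj. Qed.

Lemma hpartE i j v : v \in gr i -> hpart j v = if j == i then v else 0.
Proof.
move=> vi; case: eqP => [->|/eqP]; first exact: hpart_id.
move=> ij; apply: (@addIr _ (hpart (~~ j) v)); rewrite hpart_add add0r.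
by rewrite hpart_id //; case: i j ij vi => -[].
Qed.

End Homogeneous.
Arguments hpart {K V} i.

Section HomogeneousLift.
Variables (K : fieldType) (U V : superVectType K) (W : vectType K).

(* The linear map sending u \ox v to F i j u v for u, v homogeneous of parity
   i, j, when each F i j is bilinear. *)
Definition hlift (F : bool -> bool -> U -> V -> W) : 'Hom(tensor U V, W) :=
  tlift (fun u v => \sum_i \sum_j F i j (hpart i u) (hpart j v)).

Lemma bilin0l (f : U -> V -> W) v : bilin f -> f 0 v = 0.
Proof. by move=> [fl _]; have := fl v (-1) 0 0; rewrite !scaleN1r !addNr. Qed.

Lemma bilin0r (f : U -> V -> W) u : bilin f -> f u 0 = 0.
Proof. by move=> [_ fr]; have := fr u (-1) 0 0; rewrite !scaleN1r !addNr. Qed.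

Lemma bilin_hsum (F : bool -> bool -> U -> V -> W) :
  (forall i j, bilin (F i j)) ->
  bilin (fun u v => \sum_i \sum_j F i j (hpart i u) (hpart j v)).
Proof.
move=> FB; split=> [v c u u'|u c v v'] /=;
  rewrite scaler_sumr -big_split; apply: eq_bigr => i _ /=;
  rewrite scaler_sumr -big_split; apply: eq_bigr => j _ /=;
  by rewrite linearP /= (FB i j).1 || rewrite linearP /= (FB i j).2.
Qed.

Lemma bilin_hparts (f : U -> V -> W) : bilin f ->
  forall u v, f u v = \sum_i \sum_j f (hpart i u) (hpart j v).
Proof.
move=> [fl fr] u v; rewrite -[in LHS](hpart_sum u).
under eq_bigr do rewrite -[hpart _ _]scale1r.
rewrite (linear_sumZ (fl v)); apply: eq_bigr => i _; rewrite scale1r.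
rewrite -[in LHS](hpart_sum v); under eq_bigr do rewrite -[hpart _ _]scale1r.
by rewrite (linear_sumZ (fr _)); apply: eq_bigr => j _; rewrite scale1r.
Qed.

Lemma hsumE (F : bool -> bool -> U -> V -> W) :
  (forall i j, bilin (F i j)) -> forall i j u v, u \in gr i -> v \in gr j ->
  \sum_i \sum_j F i j (hpart i u) (hpart j v) = F i j u v.
Proof.
move=> FB i j u v ui vj.
rewrite (bigD1 i) //= (bigD1 j) //= !hpart_id // !big1 ?addr0 //.
  move=> i' ii'; rewrite big1 // => j' _.
  by rewrite (hpartE i' ui) (negPf ii') bilin0l.
by move=> j' jj'; rewrite (hpartE j' vj) (negPf jj') bilin0r.
Qed.

Lemma hliftE (F : bool -> bool -> U -> V -> W) :
  (forall i j, bilin (F i j)) ->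
  forall i j u v, u \in gr i -> v \in gr j -> hlift F (u \ox v) = F i j u v.
Proof.
move=> FB i j u v ui vj; rewrite /hlift tliftE; last exact: bilin_hsum.
exact: hsumE.
Qed.

Lemma hliftEr (F : bool -> U -> V -> W) : (forall j, bilin (F j)) ->
  forall j u v, v \in gr j -> hlift (fun _ => F) (u \ox v) = F j u v.
Proof.
move=> FB j u v vj.
rewrite /hlift tliftE; last exact: (bilin_hsum (F := fun _ => F)).
rewrite [RHS](bilin_hparts (FB j)); apply: eq_bigr => i _; apply: eq_bigr => k _.
by rewrite (hpartE k vj); case: eqP => [->|_] //; rewrite !bilin0r.
Qed.

Lemma hliftEl (F : bool -> U -> V -> W) : (forall i, bilin (F i)) ->
  forall i u v, u \in gr i -> hlift (fun i _ => F i) (u \ox v) = F i u v.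
Proof.
move=> FB i u v ui.
rewrite /hlift tliftE; last by apply: (bilin_hsum (F := fun i _ => F i)).
rewrite [RHS](bilin_hparts (FB i)); apply: eq_bigr => k _; apply: eq_bigr => j _.
by rewrite (hpartE k ui); case: eqP => [->|_] //; rewrite !bilin0l.
Qed.

Lemma htens_ext (f g : 'Hom(tensor U V, W)) :
  (forall i j u v, u \in gr i -> v \in gr j -> f (u \ox v) = g (u \ox v)) -> f = g.
Proof.
move=> fg; apply: tens_ext => u v.
have fB (h : 'Hom(tensor U V, W)) : bilin (fun u v => h (u \ox v)).
  have [tl tr] := tens_bilin U V.
  by split=> [w c x y|w c x y]; rewrite /= ?(tl w) ?(tr w) linearP.
rewrite (bilin_hparts (fB f)) (bilin_hparts (fB g)).
apply: eq_bigr => i _; apply: eq_bigr => j _; exact: fg (hpart_gr _ _) (hpart_gr _ _).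
Qed.

End HomogeneousLift.

Section Dual.
Variables (K : fieldType).

Definition dual (V : vectType K) : Type := 'Hom(V, K^o).
HB.instance Definition _ V := Vector.copy (dual V) 'Hom(V, K^o).

Variable V : superVectType K.
Implicit Type a : dual V.

(* The functionals of parity i are those vanishing on the vectors of the other
   parity. *)
Definition dual_gr (i : bool) : {vspace dual V} :=
  lker (linfun (fun a : dual V => (a \o hpart (~~ i))%VF)).

Lemma dual_grP i a :
  reflect (forall x, x \in gr (~~ i) -> a x = 0) (a \in dual_gr i).
Proof.
rewrite memv_ker linfunE; last by move=> c b b'; rewrite comp_lfunDl comp_lfunZl.
apply: (iffP eqP) => [a0 x xi|a0].
  by have /lfunP/(_ x) := a0; rewrite comp_lfunE hpart_id // zero_lfunE.
by apply/lfunP=> x; rewrite comp_lfunE zero_lfunE a0 // hpart_gr.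
Qed.

Lemma dual_gr_full : (dual_gr false + dual_gr true = fullv)%VS.
Proof.
apply/vspaceP=> a; rewrite memvf; apply/memv_addP.
have H i : (a \o hpart i)%VF \in dual_gr i.
  by apply/dual_grP=> x xi; rewrite comp_lfunE (hpartE _ xi); case: (i); rewrite linear0.
exists (a \o hpart false)%VF; rewrite ?H //; exists (a \o hpart true)%VF; rewrite ?H //.
apply/lfunP=> x; rewrite add_lfunE !comp_lfunE -linearD /=.
by rewrite (hpart_add false).
Qed.

Lemma dual_gr_direct : (dual_gr false :&: dual_gr true = 0)%VS.
Proof.
apply/eqP; rewrite -subv0; apply/subvP=> a; rewrite memv_cap memv0.
case/andP=> /dual_grP a0 /dual_grP a1; apply/eqP/lfunP=> x.
rewrite zero_lfunE -(hpart_add true x) linearD /= a0 ?hpart_gr // a1 ?hpart_gr //.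
exact: addr0.
Qed.

HB.instance Definition _ :=
  Vector_isSuper.Build K (dual V) dual_gr_full dual_gr_direct.

End Dual.

Section TensorSuper.
Variables (K : fieldType) (U V : superVectType K).

Definition tensor_gr (k : bool) : {vspace tensor U V} :=
  (\sum_i <<[seq (u : U) \ox (v : V) |
     u <- vbasis (gr i), v <- vbasis (gr (i (+) k))]>>)%VS.

Lemma tens_gr i j (u : U) (v : V) :
  u \in gr i -> v \in gr j -> u \ox v \in tensor_gr (i (+) j).
Proof.
move=> ui vj; apply/(subvP (sumv_sup i _ (subvv _))) => //.
rewrite addKb; have [tl tr] := tens_bilin U V.
rewrite (coord_vbasis ui) (linear_sumZ (tl v)); apply: memv_suml => a _.
rewrite (coord_vbasis vj) (linear_sumZ (tr _)).
apply/memvZ/memv_suml => b _; apply/memvZ/memv_span/allpairs_f; apply: mem_nth;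
  by rewrite size_tuple.
Qed.

Let part (k : bool) : 'End(tensor U V) :=
  hlift (fun i j u v => if i (+) j == k then u \ox v else 0).

Let partE k i j (u : U) (v : V) : u \in gr i -> v \in gr j ->
  part k (u \ox v) = if i (+) j == k then u \ox v else 0.
Proof.
move=> ui vj; rewrite /part (hliftE _ ui vj) // => i' j'.
case: (_ == k); first exact: tens_bilin.
by split=> w c x y; rewrite scaler0 addr0.
Qed.

Let part_gr k l t : t \in tensor_gr l -> part k t = if l == k then t else 0.
Proof.
move=> tl; suff: t \in lker (part k - (if l == k then \1%VF else 0)).
  rewrite memv_ker add_lfunE opp_lfunE subr_eq0 => /eqP ->.
  by case: ifP; rewrite ?id_lfunE ?zero_lfunE.
apply/subvP: t tl; apply/subv_sumP=> i _; apply/span_subvP=> _ /allpairsP[[u v] /= [ui vj ->]].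
rewrite memv_ker add_lfunE opp_lfunE subr_eq0 (partE _ (vbasis_mem ui) (vbasis_mem vj)) addKb.
by case: ifP; rewrite ?id_lfunE ?zero_lfunE.
Qed.

Lemma tensor_gr_full : (tensor_gr false + tensor_gr true = fullv)%VS.
Proof.
apply/vspaceP=> t; rewrite memvf; rewrite (tensE t).
apply: memv_suml => i _; apply: memv_suml => j _; apply: memvZ.
rewrite (bilin_hparts (tens_bilin U V)).
apply: memv_suml => a _; apply: memv_suml => b _.
have := tens_gr (hpart_gr a _) (hpart_gr b _).
by case: (a (+) b) => H; [apply: (subvP (addvSr _ _))|apply: (subvP (addvSl _ _))].
Qed.

Lemma tensor_gr_direct : (tensor_gr false :&: tensor_gr true = 0)%VS.
Proof.
apply/eqP; rewrite -subv0; apply/subvP=> t; rewrite memv_cap memv0.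
by case/andP=> t0 t1; have /= <- := part_gr false t0; rewrite (part_gr _ t1).
Qed.

HB.instance Definition _ :=
  Vector_isSuper.Build K (tensor U V) tensor_gr_full tensor_gr_direct.

End TensorSuper.

Section PairSuper.
Variables (K : fieldType) (U V : superVectType K).

Definition inl_lfun : 'Hom(U, (U * V)%type) := linfun (fun u => (u, 0)).
Definition inr_lfun : 'Hom(V, (U * V)%type) := linfun (fun v => (0, v)).

Lemma inl_lfunE u : inl_lfun u = (u, 0).
Proof. by rewrite linfunE // => c x y; congr (_, _); rewrite /= scaler0 addr0. Qed.

Lemma inr_lfunE v : inr_lfun v = (0, v).
Proof. by rewrite linfunE // => c x y; congr (_, _); rewrite /= scaler0 addr0. Qed.

Definition pair_gr (i : bool) : {vspace (U * V)%type} :=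
  (inl_lfun @: gr i + inr_lfun @: gr i)%VS.

Lemma pair_grP i (w : (U * V)%type) :
  (w \in pair_gr i) = (w.1 \in gr i) && (w.2 \in gr i).
Proof.
apply/memv_addP/andP=> [[_ /memv_imgP[u ui ->]] [_ /memv_imgP[v vi ->]] ->|[]].
  by rewrite inl_lfunE inr_lfunE /= add0r addr0.
case: w => u v /= ui vi.
exists (inl_lfun u); first exact: memv_img.
exists (inr_lfun v); first exact: memv_img.
by rewrite inl_lfunE inr_lfunE; congr (_, _); rewrite /= ?add0r ?addr0.
Qed.

Lemma pair_gr_full : (pair_gr false + pair_gr true = fullv)%VS.
Proof.
apply/vspaceP=> -[u v]; rewrite memvf; apply/memv_addP.
have H i : (hpart i u, hpart i v) \in pair_gr i by rewrite pair_grP !hpart_gr.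
exists (hpart false u, hpart false v); first exact: H.
exists (hpart true u, hpart true v); first exact: H.
by congr (_, _); rewrite (hpart_add false).
Qed.

Lemma pair_gr_direct : (pair_gr false :&: pair_gr true = 0)%VS.
Proof.
apply/eqP; rewrite -subv0; apply/subvP=> -[u v]; rewrite memv_cap memv0 !pair_grP /=.
case/andP=> /andP[u0 v0] /andP[u1 v1].
by rewrite -(hpart_id u0) (hpartE _ u1) -(hpart_id v0) (hpartE _ v1).
Qed.

HB.instance Definition _ :=
  Vector_isSuper.Build K (U * V)%type pair_gr_full pair_gr_direct.

End PairSuper.

Section Nondegenerate.
Variables (K : fieldType).

Lemma dim_dual (V : vectType K) : \dim {:dual V} = \dim {:V}.
Proof. by rewrite !dimvf; exact: muln1. Qed.

Lemma dim_tensor (U V : vectType K) : \dim {:tensor U V} = (\dim {:U} * \dim {:V})%N.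
Proof. by rewrite dimvf. Qed.

Lemma lker0_dim_lfunVK (A B : vectType K) (f : 'Hom(A, B)) :
  lker f == 0%VS -> \dim {:A} = \dim {:B} -> cancel f^-1%VF f.
Proof.
move=> f0 dAB y; apply: limg_lfunVK.
suff -> : limg f = fullv by exact: memvf.
by apply/eqP; rewrite eqEdim subvf /= limg_dim_eq ?dAB // (eqP f0) capv0.
Qed.

Lemma dual_sep (V : vectType K) (v : V) : (forall a : dual V, a v = 0) -> v = 0.
Proof.
move=> v0; rewrite (coord_vbasis (memvf v)) big1 // => i _.
have := v0 (linfun (coord (vbasis fullv) i : V -> K^o)); rewrite lfunE /= => ->.
exact: scale0r.
Qed.

End Nondegenerate.

Section Duality.
Variables (K : fieldType) (U V : superVectType K) (b : 'Hom(U, dual V)).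

Definition perfect : bool := (lker b == 0)%VS && (\dim {:U} == \dim {:V}).

(* <u1 \ox u2, v1 \ox v2> = (-1)^(|u2||v1|) <u1, v1> <u2, v2>, where
   <u, v> = b u v *)
Definition tpair : 'Hom(tensor U U, dual (tensor V V)) :=
  hlift (fun _ j u1 u2 => hlift (fun k _ v1 v2 =>
    (-1) ^+ (j && k) *: (b u1 v1 * b u2 v2 : K^o))).

Definition rpair : 'Hom(V, dual U) := linfun (fun v => linfun (fun u => b u v)).

(* <u, m v w> = <delta u, v \ox w> *)
Definition dual_mul (delta : 'Hom(U, tensor U U)) : 'Hom(V, 'End(V)) :=
  linfun (fun v => linfun (fun w =>
    (rpair^-1)%VF (linfun (fun u => tpair (delta u) (v \ox w))))).

(* <delta u, v \ox w> = <u, m v w> *)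
Definition dual_comul (m : 'Hom(V, 'End(V))) : 'Hom(U, tensor U U) :=
  linfun (fun u => (tpair^-1)%VF (tlift (fun v w => b u (m v w)))).

(* <rs v u, w> = - (-1)^(|v||u|) <u, r v w> *)
Definition coadj (r : 'Hom(V, 'End(V))) : 'Hom(V, 'End(U)) :=
  linfun (fun v => linfun (fun u => (b^-1)%VF (linfun (fun w => \sum_i \sum_j
    - (-1) ^+ (i && j) *: b (hpart j u) (r (hpart i v) w))))).

Let bD c u u' v : b (c *: u + u') v = c *: b u v + b u' v.
Proof. by rewrite linearP /= add_lfunE scale_lfunE. Qed.

Let rD (W1 W2 : vectType K) (r : 'Hom(W1, 'End(W2))) c x x' y :
  r (c *: x + x') y = c *: r x y + r x' y.
Proof. by rewrite linearP /= add_lfunE scale_lfunE. Qed.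

Let mul_bilin (c : K) u1 u2 :
  bilin (fun v1 v2 => c *: (b u1 v1 * b u2 v2 : K^o)).
Proof.
split=> [v d x y|v d x y] /=; rewrite linearP /=.
  by rewrite mulrDl -scalerAl scalerDr !scalerA [c * d]mulrC.
by rewrite mulrDr -scalerAr scalerDr !scalerA [c * d]mulrC.
Qed.

Lemma tpairE j k u1 u2 v1 v2 : u2 \in gr j -> v1 \in gr k ->
  tpair (u1 \ox u2) (v1 \ox v2) = (-1) ^+ (j && k) * (b u1 v1 * b u2 v2).
Proof.
move=> u2j v1k.
pose F (j k : bool) u1 u2 := fun v1 v2 => (-1) ^+ (j && k) *: (b u1 v1 * b u2 v2 : K^o).
have FE j' x y k' v v' : v \in gr k' ->
    hlift (fun k _ => F j' k x y) (v \ox v') = F j' k' x y v v'.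
  by move=> vk; rewrite (hliftEl (F := fun k => F j' k x y) _ _ vk) // => *; exact: mul_bilin.
have FB j' : bilin (fun x y => hlift (fun k _ => F j' k x y)).
  split=> [z d x y|z d x y] /=; apply: htens_ext => k' l' v v' vk vl;
    rewrite add_lfunE scale_lfunE !(FE _ _ _ _ _ _ vk) /F bD.
    by rewrite mulrDl -scalerAl scalerDr !scalerA [d * _]mulrC.
  by rewrite mulrDr -scalerAr scalerDr !scalerA [d * _]mulrC.
by rewrite /tpair (hliftEr FB _ u2j) (FE _ _ _ _ _ _ v1k).
Qed.

Lemma rpairE v u : rpair v u = b u v.
Proof.
rewrite linfunE; first by rewrite linfunE // => c x y; rewrite bD.
move=> c x y; apply/lfunP=> z; rewrite add_lfunE scale_lfunE.
by rewrite !linfunE ?linearP // => d s t; rewrite bD.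
Qed.

Hypothesis b_perfect : perfect.

Lemma rpair_ker0 : lker rpair == 0%VS.
Proof.
have /andP[b0 /eqP dUV] := b_perfect.
apply/lker0P=> v v' vv'; apply/eqP; rewrite -subr_eq0; apply/eqP/dual_sep => a.
have ea : b ((b^-1)%VF a) = a by apply: lker0_dim_lfunVK; rewrite ?dim_dual.
by rewrite -ea linearB /= -!rpairE vv' subrr.
Qed.

Lemma rpairK : cancel (rpair^-1)%VF rpair.
Proof.
apply: lker0_dim_lfunVK rpair_ker0 _; rewrite dim_dual.
by have /andP[_ /eqP ->] := b_perfect.
Qed.

Lemma lpairK : cancel (b^-1)%VF b.
Proof. by have /andP[b0 /eqP dUV] := b_perfect; apply: lker0_dim_lfunVK; rewrite ?dim_dual. Qed.

Lemma tpair_ker0 : lker tpair == 0%VS.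
Proof.
have [tl tr] := tens_bilin U U.
pose G v w : 'Hom(tensor U U, K^o) := tlift (fun u1 u2 => b u1 v * b u2 w : K^o).
have GB v w : bilin (fun u1 u2 => b u1 v * b u2 w : K^o).
  split=> [z d x y|z d x y] /=; rewrite bD.
    by rewrite mulrDl -scalerAl.
  by rewrite mulrDr -scalerAr.
have GE v w u1 u2 : G v w (u1 \ox u2) = b u1 v * b u2 w by rewrite /G tliftE.
pose Q : 'End(tensor U U) := hlift (fun _ j u1 u2 => (-1) ^+ j *: (u1 \ox u2)).
have QE j u1 u2 : u2 \in gr j -> Q (u1 \ox u2) = (-1) ^+ j *: (u1 \ox u2).
  move=> uj; rewrite /Q (hliftEr (F := fun j u1 u2 => (-1) ^+ j *: (u1 \ox u2)) _ _ uj) //.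
  move=> k; split=> [z d x y|z d x y] /=; rewrite ?tl ?tr scalerDr !scalerA.
    by rewrite mulrC.
  by rewrite mulrC.
have H T v w k : v \in gr k -> tpair T (v \ox w) = G v w (if k then Q T else T).
  move=> vk; pose f : 'Hom(tensor U U, K^o) := linfun (fun T => tpair T (v \ox w)).
  have fE T' : f T' = tpair T' (v \ox w).
    by rewrite /f linfunE // => d x y; rewrite linearP /= add_lfunE scale_lfunE.
  rewrite -fE; suff -> : f = if k then (G v w \o Q)%VF else G v w.
    by case: (k); rewrite ?comp_lfunE.
  apply: htens_ext => i j u1 u2 _ uj; rewrite fE (tpairE _ _ uj vk).
  case: (k); rewrite ?andbT ?andbF ?comp_lfunE ?(QE _ _ _ uj) ?linearZ /= GE //.
  exact: mul1r.
suff ker0 S : tpair S = 0 -> S = 0.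
  apply/lker0P => T T' TT'; apply/eqP; rewrite -subr_eq0; apply/eqP/ker0.
  by rewrite linearB /= TT' subrr.
move=> S0.
have G0 v w : G v w S = 0.
  have Gadd x y : G (x + y) w S = G x w S + G y w S.
    rewrite -add_lfunE; congr (fun_of_lfun _ S); apply: tens_ext => u1 u2.
    by rewrite add_lfunE !GE linearD mulrDl.
  rewrite -(hpart_add false v) Gadd.
  have /= <- := H S _ w false (hpart_gr _ v).
  set vo := hpart (~~ false) v; have vo1 : vo \in gr true by exact: hpart_gr.
  pose w' := (rpair^-1)%VF (linfun (fun u => b (\sum_(j : bool) (-1) ^+ j *: hpart j u) w)).
  have w'E j u : u \in gr j -> b u w' = (-1) ^+ j * b u w.
    move=> uj; rewrite -rpairE rpairK linfunE; last first.
      move=> d x y; rewrite -bD; congr (b _ w).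
      rewrite scaler_sumr -big_split; apply: eq_bigr => l _ /=.
      by rewrite linearP scalerDr !scalerA mulrC.
    rewrite (bigD1 j) //= big1 ?addr0 ?hpart_id ?linearZ ?scale_lfunE //.
    by move=> l lj; rewrite (hpartE _ uj) (negPf lj) scaler0.
  have <- : G vo w' (Q S) = G vo w S.
    rewrite -comp_lfunE; congr (fun_of_lfun _ S); apply: htens_ext => i j u1 u2 _ uj.
    rewrite comp_lfunE (QE _ _ _ uj) linearZ /= !GE (w'E _ _ uj).
    by rewrite /GRing.scale /= mulrCA [X in _ * X]mulrA -signr_addb addbb mul1r.
  have /= <- := H S _ w' true vo1.
  by rewrite S0 !zero_lfunE addr0.
apply/matrixP=> i j; rewrite mxE.
pose e (k : 'I_(\dim {:U})) : dual U := linfun (coord (vbasis fullv) k : U -> K^o).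
have eE k u : b u ((rpair^-1)%VF (e k)) = coord (vbasis fullv) k u.
  by rewrite -rpairE rpairK lfunE.
have := G0 ((rpair^-1)%VF (e i)) ((rpair^-1)%VF (e j)).
rewrite /G tlift_sum; have fU := basis_free (vbasisP {:U}).
rewrite (bigD1 i) //= (bigD1 j) //= !eE !coord_free // !eqxx mulr1 !big1 ?addr0.
- by rewrite /GRing.scale /= mulr1.
- move=> k ki; rewrite big1 // => l _; rewrite !eE !coord_free //.
  by rewrite (negPf ki) mul0r scaler0.
- move=> l lj; rewrite !eE !coord_free //.
  by rewrite (negPf lj) mulr0 scaler0.
Qed.

Lemma tpairK : cancel (tpair^-1)%VF tpair.
Proof.
apply: lker0_dim_lfunVK tpair_ker0 _; rewrite dim_dual !dim_tensor.
by have /andP[_ /eqP ->] := b_perfect.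
Qed.

Lemma dual_mulE delta u v w : b u (dual_mul delta v w) = tpair (delta u) (v \ox w).
Proof.
have [tl tr] := tens_bilin V V.
have L v' w' : linear (fun u => tpair (delta u) (v' \ox w')).
  by move=> c x y; rewrite linearP /= linearP /= add_lfunE scale_lfunE.
have R v' : linear (fun w => (rpair^-1)%VF (linfun (fun u => tpair (delta u) (v' \ox w)))).
  move=> c x y; rewrite -linearP; congr (_ _); apply/lfunP=> z.
  by rewrite add_lfunE scale_lfunE !(linfunE (@L _ _)) tr linearP.
have T : linear (fun v => linfun (fun w =>
    (rpair^-1)%VF (linfun (fun u => tpair (delta u) (v \ox w))))).
  move=> c x y; apply/lfunP=> z; rewrite add_lfunE scale_lfunE !(linfunE (R _)) -linearP.
  congr (_ _); apply/lfunP=> t.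
  by rewrite add_lfunE scale_lfunE !(linfunE (@L _ _)) tl linearP.
by rewrite -rpairE /dual_mul (linfunE T) (linfunE (R _)) rpairK (linfunE (@L _ _)).
Qed.

Lemma dual_comulE m u v w : tpair (dual_comul m u) (v \ox w) = b u (m v w).
Proof.
have B u' : bilin (fun v w => b u' (m v w)).
  by split=> [z c x y|z c x y] /=; rewrite ?rD !linearP.
have T : linear (fun u => (tpair^-1)%VF (tlift (fun v w => b u (m v w)))).
  move=> c x y; rewrite -linearP; congr (_ _); apply: tens_ext => s t.
  by rewrite add_lfunE scale_lfunE !tliftE // bD.
by rewrite /dual_comul (linfunE T) tpairK tliftE.
Qed.

Lemma coadjE r i j v u w : v \in gr i -> u \in gr j ->
  b (coadj r v u) w = - ((-1) ^+ (i && j) * b u (r v w)).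
Proof.
move=> vi uj.
have B w' (c : K) : bilin (fun (v : V) (u : U) => c *: b u (r v w')).
  split=> [u' d x y|v' d x y] /=; first by rewrite rD linearP scalerDr !scalerA [c * d]mulrC.
  by rewrite bD scalerDr !scalerA [c * d]mulrC.
pose F w' := fun v u => \sum_i \sum_j - (-1) ^+ (i && j) *: b (hpart j u) (r (hpart i v) w').
have FB w' : bilin (F w').
  by apply: (@bilin_hsum _ _ _ _ (fun i j v u => - (-1) ^+ (i && j) *: b u (r v w'))) => *; exact: B.
have L v' u' : linear (fun w => F w v' u').
  move=> d x y; rewrite /F scaler_sumr -big_split; apply: eq_bigr => i' _ /=.
  rewrite scaler_sumr -big_split; apply: eq_bigr => j' _ /=.
  by rewrite !linearP.
rewrite /coadj linfun2E; last first.
  split=> [u' d x y|v' d x y] /=; rewrite -linearP; congr (_ _); apply/lfunP=> z;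
    rewrite add_lfunE scale_lfunE !(linfunE (L _ _)).
    exact: (FB z).1.
  exact: (FB z).2.
rewrite lpairK (linfunE (L _ _)) /F.
rewrite (@hsumE _ _ _ _ (fun i j v u => - (-1) ^+ (i && j) *: b u (r v w)) _ _ _ _ _ vi uj).
  exact: mulNr.
by move=> *; exact: B.
Qed.

End Duality.

Section Pairing.
Variables (K : fieldType) (P : superVectType K).

Definition dpair : 'Hom(dual P, dual P) := \1%VF.

(* <x, a> = (-1)^(|x||a|) <a, x> *)
Definition bpair : 'Hom(P, dual (dual P)) :=
  linfun (fun x => linfun (fun a : dual P =>
    \sum_i \sum_j (-1) ^+ (i && j) *: (hpart j a) (hpart i x))).

Lemma dpairE a x : dpair a x = a x.
Proof. by rewrite id_lfunE. Qed.

Let scale_bilin (c : K) : bilin (fun (x : P) (a : dual P) => c *: a x).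
Proof.
split=> [a d x y|x d a a'] /=; first by rewrite !linearP.
by rewrite add_lfunE scale_lfunE scalerDr !scalerA [c * d]mulrC.
Qed.

Lemma bpairE i j x (a : dual P) : x \in gr i -> a \in gr j ->
  bpair x a = (-1) ^+ (i && j) * a x.
Proof.
move=> xi aj; pose F i j := fun (x : P) (a : dual P) => (-1) ^+ (i && j) *: a x.
have FB i' j' : bilin (F i' j') by exact: scale_bilin.
by rewrite /bpair (linfun2E (bilin_hsum FB)) (hsumE FB xi aj).
Qed.

Lemma dpair_perfect : perfect dpair.
Proof. by rewrite /perfect dim_dual eqxx andbT; apply/lker0P=> x y; rewrite !id_lfunE. Qed.

Lemma bpair_perfect : perfect bpair.
Proof.
rewrite /perfect !dim_dual eqxx andbT; apply/lker0P=> x y xy.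
apply/eqP; rewrite -subr_eq0; apply/eqP; set z := x - y.
have z0 : bpair z = 0 by rewrite linearB /= xy subrr.
rewrite -(hpart_sum z) big1 // => i _; apply: dual_sep => a.
pose ai : dual P := (a \o hpart i)%VF.
have aii : ai \in gr i.
  by apply/dual_grP=> t ti; rewrite comp_lfunE (hpartE _ ti); case: (i); rewrite linear0.
have B (j : bool) : ai (hpart (~~ i) z) = 0.
  by have /dual_grP := aii; apply; exact: hpart_gr.
have := congr1 (fun f : dual (dual P) => f ai) z0.
rewrite zero_lfunE -{1}(hpart_add i z) linearD add_lfunE.
rewrite (bpairE (hpart_gr _ _) aii) (bpairE (hpart_gr (~~ i) _) aii) B // mulr0 addr0.
rewrite comp_lfunE (hpart_id (hpart_gr i z)) => /eqP.
by rewrite mulf_eq0 signr_eq0 => /eqP.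
Qed.

End Pairing.

Section TensorMaps.
Variable K : fieldType.

(* f \otimes g without Koszul sign; only used with even f and g *)
Definition tmap (U U' V V' : vectType K) (f : 'Hom(U, U')) (g : 'Hom(V, V')) :
    'Hom(tensor U V, tensor U' V') :=
  tlift (fun u v => f u \ox g v).

Definition tassoc (U V W : vectType K) :
    'Hom(tensor (tensor U V) W, tensor U (tensor V W)) :=
  tlift (fun t w => tlift (fun u v => u \ox (v \ox w)) t).

Definition tassocV (U V W : vectType K) :
    'Hom(tensor U (tensor V W), tensor (tensor U V) W) :=
  tlift (fun u t => tlift (fun v w => (u \ox v) \ox w) t).

Variable P : superVectType K.

Definition tswap : 'End(tensor P P) :=
  hlift (fun i j x y => (-1) ^+ (i && j) *: (y \ox x)).

(* xi; the second parity, that of t = y \ox z, is |y| + |z| *)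
Definition tcycle : 'End(tensor P (tensor P P)) :=
  hlift (fun i j x t => (-1) ^+ (i && j) *: tlift (fun y z => y \ox (z \ox x)) t).

Definition tswap12 : 'End(tensor P (tensor P P)) :=
  (tassoc P P P \o tmap tswap \1 \o tassocV P P P)%VF.

End TensorMaps.

Section Even.
Variable K : fieldType.

Definition even_map (U V : superVectType K) (f : 'Hom(U, V)) : Prop :=
  forall i u, u \in gr i -> f u \in gr i.

(* f as a bilinear map, or as a linear map U -> End(V) *)
Definition even_bilin (U V W : superVectType K) (f : 'Hom(U, 'Hom(V, W))) : Prop :=
  forall i j u v, u \in gr i -> v \in gr j -> f u v \in gr (i (+) j).

End Even.

Section Poisson.
Variables (K : fieldType) (P : superVectType K).

Record poisson_superalgebra (br mul : 'Hom(P, 'End(P))) : Prop := {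
  br_even : even_bilin br;
  mul_even : even_bilin mul;
  br_skew : forall i j (x y : P), x \in gr i -> y \in gr j ->
    br x y = - ((-1) ^+ (i && j) *: br y x);
  br_jacobi : forall i j k (x y z : P),
    x \in gr i -> y \in gr j -> z \in gr k ->
    (-1) ^+ (i && k) *: br x (br y z) + (-1) ^+ (k && j) *: br z (br x y)
      + (-1) ^+ (j && i) *: br y (br z x) = 0;
  mul_comm : forall i j (x y : P), x \in gr i -> y \in gr j ->
    mul x y = (-1) ^+ (i && j) *: mul y x;
  mul_assoc : forall x y z : P, mul x (mul y z) = mul (mul x y) z;
  br_leibniz : forall i j (x y z : P), x \in gr i -> y \in gr j ->
    br x (mul y z) = mul (br x y) z + (-1) ^+ (i && j) *: mul y (br x z)
}.

(* ad(x) on the tensor square, for x of parity i *)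
Definition tens_ad (br : 'Hom(P, 'End(P))) (i : bool) (x : P) :
    'End(tensor P P) :=
  hlift (fun k _ y1 y2 =>
    br x y1 \ox y2 + (-1) ^+ (i && k) *: (y1 \ox br x y2)).

Record poisson_superbialgebra (br mul : 'Hom(P, 'End(P)))
    (delta Delta : 'Hom(P, tensor P P)) : Prop := {
  bialg_poisson : poisson_superalgebra br mul;
  delta_even : even_map delta;
  Delta_even : even_map Delta;
  delta_skew : (tswap P \o delta)%VF = - delta;
  delta_jacobi :
    ((\1 + tcycle P + (tcycle P \o tcycle P)) \o (tmap \1 delta \o delta))%VF = 0;
  Delta_comm : (tswap P \o Delta)%VF = Delta;
  Delta_assoc :
    (tmap \1 Delta \o Delta)%VF = (tassoc P P P \o (tmap Delta \1 \o Delta))%VF;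
  delta_Delta_leibniz :
    (tmap \1 Delta \o delta)%VF =
      (tassoc P P P \o (tmap delta \1 \o Delta))%VF
      + (tswap12 P \o (tmap \1 delta \o Delta))%VF;
  delta_br : forall i j (x y : P), x \in gr i -> y \in gr j ->
    delta (br x y) =
      tens_ad br i x (delta y) - (-1) ^+ (i && j) *: tens_ad br j y (delta x);
  Delta_mul : forall x y : P,
    Delta (mul x y) =
      tlift (fun y1 y2 => mul x y1 \ox y2) (Delta y)
      + tlift (fun x1 x2 => x1 \ox mul x2 y) (Delta x);
  delta_mul : forall i j (x y : P), x \in gr i -> y \in gr j ->
    delta (mul x y) =
      (-1) ^+ (i && j) *: tlift (fun x1 x2 => mul y x1 \ox x2) (delta x)
      + tlift (fun y1 y2 => mul x y1 \ox y2) (delta y)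
      + hlift (fun k _ y1 y2 => (-1) ^+ (i && k) *: (y1 \ox br x y2)) (Delta y)
      + hlift (fun k _ x1 x2 =>
          (-1) ^+ ((i && j) (+) (j && k)) *: (x1 \ox br y x2)) (Delta x);
  Delta_br : forall i j (x y : P), x \in gr i -> y \in gr j ->
    Delta (br x y) =
      tlift (fun y1 y2 => br x y1 \ox y2) (Delta y)
      + hlift (fun k _ y1 y2 => (-1) ^+ (i && k) *: (y1 \ox br x y2)) (Delta y)
      + (-1) ^+ (i && j) *: hlift (fun k _ x1 x2 =>
          mul y x1 \ox x2 - (-1) ^+ (j && k) *: (x1 \ox mul y x2)) (delta x)
}.

End Poisson.

Section MatchedPair.
Variable K : fieldType.

Record matched_pair_half (P1 P2 : superVectType K)
    (br1 mul1 : 'Hom(P1, 'End(P1)))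
    (rho1 phi1 : 'Hom(P1, 'End(P2))) (rho2 phi2 : 'Hom(P2, 'End(P1))) : Prop := {
  rho_even : even_bilin rho1;
  phi_even : even_bilin phi1;
  rho_br : forall i j (x y : P1), x \in gr i -> y \in gr j ->
    rho1 (br1 x y) =
      (rho1 x \o rho1 y)%VF - (-1) ^+ (i && j) *: (rho1 y \o rho1 x)%VF;
  phi_mul : forall x y : P1, phi1 (mul1 x y) = (phi1 x \o phi1 y)%VF;
  rho_mul : forall i j (x y : P1), x \in gr i -> y \in gr j ->
    rho1 (mul1 x y) =
      (phi1 x \o rho1 y)%VF + (-1) ^+ (i && j) *: (phi1 y \o rho1 x)%VF;
  phi_br : forall i j (x y : P1), x \in gr i -> y \in gr j ->
    phi1 (br1 x y) =
      (rho1 x \o phi1 y)%VF - (-1) ^+ (i && j) *: (phi1 y \o rho1 x)%VF;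
  matched_br : forall i j k (x y : P1) (a : P2),
    x \in gr i -> y \in gr j -> a \in gr k ->
    rho2 a (br1 x y) =
      br1 (rho2 a x) y + (-1) ^+ (i && k) *: br1 x (rho2 a y)
      + (-1) ^+ ((i && j) (+) (j && k)) *: rho2 (rho1 y a) x
      - (-1) ^+ (i && k) *: rho2 (rho1 x a) y;
  matched_mul : forall i k (x y : P1) (a : P2), x \in gr i -> a \in gr k ->
    phi2 a (mul1 x y) =
      mul1 (phi2 a x) y + (-1) ^+ (i && k) *: phi2 (phi1 x a) y;
  matched_leibniz1 : forall i j k (x y : P1) (a : P2),
    x \in gr i -> y \in gr j -> a \in gr k ->
    rho2 a (mul1 x y) =
      mul1 (rho2 a x) y + (-1) ^+ (k && i) *: mul1 x (rho2 a y)
      - (-1) ^+ (k && i) *: phi2 (rho1 x a) y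
      - (-1) ^+ ((k && j) (+) (i && j)) *: phi2 (rho1 y a) x;
  matched_leibniz2 : forall i j k (x y : P1) (a : P2),
    x \in gr i -> y \in gr j -> a \in gr k ->
    br1 x (phi2 a y)
      - (-1) ^+ ((i && k) (+) (i && j) (+) (k && j)) *: rho2 (phi1 y a) x =
    phi2 (rho1 x a) y - (-1) ^+ (i && k) *: mul1 (rho2 a x) y
      + (-1) ^+ (i && k) *: phi2 a (br1 x y)
}.

Record matched_pair (P1 P2 : superVectType K)
    (br1 mul1 : 'Hom(P1, 'End(P1))) (br2 mul2 : 'Hom(P2, 'End(P2)))
    (rho1 phi1 : 'Hom(P1, 'End(P2))) (rho2 phi2 : 'Hom(P2, 'End(P1))) : Prop := {
  matched_poisson1 : poisson_superalgebra br1 mul1;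
  matched_poisson2 : poisson_superalgebra br2 mul2;
  matched_half1 : matched_pair_half br1 mul1 rho1 phi1 rho2 phi2;
  matched_half2 : matched_pair_half br2 mul2 rho2 phi2 rho1 phi1
}.

End MatchedPair.

Section ManinTriple.
Variable K : fieldType.

Definition invariant_form (V : superVectType K) (br mul : 'Hom(V, 'End(V)))
    (B : V -> V -> K) : Prop :=
  (forall u v w, B (br u v) w = B u (br v w)) /\
  (forall u v w, B (mul u v) w = B u (mul v w)).

Definition isotropic (V : superVectType K) (B : V -> V -> K) (W : {vspace V}) : Prop :=
  {in W &, forall u v, B u v = 0}.

(* The injection f identifies (P, br', mul') with a sub-superalgebra of
   (V, br, mul). *)
Definition poisson_embedding (P V : superVectType K) (br' mul' : 'Hom(P, 'End(P)))
    (br mul : 'Hom(V, 'End(V))) (f : 'Hom(P, V)) : Prop :=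
  (forall x y, br (f x) (f y) = f (br' x y)) /\
  (forall x y, mul (f x) (f y) = f (mul' x y)).

Variable P : superVectType K.
Local Notation D := (P * dual P)%type.

(* B_p(x + a, y + b) = <x, b> + <a, y> *)
Definition manin_form (u v : D) : K := bpair P u.1 v.2 + dpair P u.2 v.1.

Definition standard_manin_triple (br1 mul1 : 'Hom(P, 'End(P)))
    (br2 mul2 : 'Hom(dual P, 'End(dual P))) : Prop :=
  exists br mul : 'Hom(D, 'End(D)),
    [/\ poisson_superalgebra br mul,
        poisson_embedding br1 mul1 br mul (inl_lfun P (dual P)),
        poisson_embedding br2 mul2 br mul (inr_lfun P (dual P)),
        isotropic manin_form (limg (inl_lfun P (dual P))) /\
        isotropic manin_form (limg (inr_lfun P (dual P)))
      & invariant_form br mul manin_form].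

End ManinTriple.

(* Main.v *)
Require Import Defs.
From mathcomp Require Import all_boot all_order all_algebra.
From mathcomp Require Import ring.

Set Implicit Arguments.
Unset Strict Implicit.
Unset Printing Implicit Defensive.

Import GRing.Theory.
Local Open Scope ring_scope.

(* Contract the first tensor factor against a functional a. The dual relations say
   that the contraction of delta(u) is the coadjoint vector ad*(a)u up to the sign
   -(-1)^|a|, and the contraction of Delta(u) is -L*(a)u up to (-1)^|a|; moving an
   operator from the first factor onto a gives a coadjoint operator again. Hence
   contracting the compatibility conditions (d), (e), (f), (g) of a bialgebra yields
   exactly the conditions (M1), (M2), (M3) of a matched pair, and nothing is lost
   because contractions separate tensors. The conditions (a), (b), (c) are dual to the
   Poisson axioms of P*, and the representation axioms (R) to those of P.

   For the Manin triple, invariance of B_p forces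
   {x, a} = ad*(x)a - (-1)^(|x||a|) ad*(a)x, and similarly for the product. The P- and
   P*-components of the Poisson axioms on P + P*, evaluated on arguments lying in P or
   P*, are then the axioms of the summands, (M1), (M2), (M3) and (R). *)

(** Most statements are needed twice, for P and for its dual, but P** is not literally P, and the
    summands of P + P* are not interchangeable as types. Hence the argument runs over abstract
    superspaces [U], [V] with two perfect pairings that differ by the Koszul sign, and over any
    biproduct [D] of them; exchanging [U] and [V] is then a symmetry and each half is proved once.
    On [D], bracket and product are treated together through a sign [e]: -1 for skew-symmetry, 1 for
    commutativity. The minus sign of -L* gives the coadjoint relation of the product the value 1
    where that of the bracket has -1. Signs are the main obstacle. An even pairing vanishes on
    arguments of different parity, so the parity of a tensor leg may be replaced by that of the
    vector paired with it, and the sign becomes a constant that leaves the contraction. The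
    remaining identities between signs are checked over all parities. *)

Lemma lfun_hext (K : fieldType) (U : superVectType K) (W : vectType K)
    (f g : 'Hom(U, W)) :
  (forall i u, u \in gr i -> f u = g u) -> f = g.
Proof.
move=> fg; apply/lfunP=> u; rewrite -(hpart_sum u) !linear_sum.
by apply: eq_bigr => i _; apply: fg (hpart_gr _ _).
Qed.

(** * Contraction of the first tensor factor *)

Section Contraction.
Variables (K : fieldType) (U : vectType K).

Definition contract (W : vectType K) (f : dual U) : 'Hom(tensor U W, W) :=
  tlift (fun u w => f u *: w).

Lemma contractE (W : vectType K) (f : dual U) u (w : W) :
  contract W f (u \ox w) = f u *: w.
Proof.
rewrite /contract tliftE //; split=> [z c x y|z c x y] /=.
  by rewrite linearP scalerDl -scalerA.
by rewrite scalerDr !scalerA mulrC.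
Qed.

(** The coordinate functional of the i-th basis vector, followed by the j-th coordinate, reads off
    the entry (i, j) of the matrix that represents the tensor. *)
Lemma contract_sep (W : vectType K) (t : tensor U W) :
  (forall f, contract W f t = 0) -> t = 0.
Proof.
move=> t0; apply/matrixP=> i j; rewrite mxE.
have fU := basis_free (vbasisP {:U}); have fW := basis_free (vbasisP {:W}).
pose e : dual U := linfun (coord (vbasis fullv) i : U -> K^o).
have := t0 e; rewrite /contract tlift_sum (bigD1 i) //= [X in _ + X]big1 => [|k ki].
  rewrite addr0 => /(congr1 (coord (vbasis fullv) j)); rewrite linear0 => <-.
  rewrite linear_sum (bigD1 j) //= big1 ?addr0 => [|l lj].
    by rewrite !linearZ /= !coord_free // lfunE /= coord_free // !eqxx !mulr1.
  by rewrite !linearZ /= coord_free // (negPf lj) !mulr0.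
apply: big1 => l _; rewrite lfunE /= coord_free // (negPf ki).
by rewrite scale0r scaler0.
Qed.

End Contraction.

(** * Superspaces in duality *)

Section DualPair.
Variable K : fieldType.

(** Evaluation of P* on P carries no sign, while the pairing of P with P* does. Keeping both maps,
    and asking both to be perfect, makes the notion symmetric. *)
Record dual_pair (U V : superVectType K) (b : 'Hom(U, dual V))
    (b' : 'Hom(V, dual U)) : Prop := {
  pair_perfectl : perfect b;
  pair_perfectr : perfect b';
  pair_even : forall i j u v, u \in gr i -> v \in gr j -> i != j -> b u v = 0;
  pair_flip : forall i j u v, u \in gr i -> v \in gr j ->
    b' v u = (-1) ^+ (i && j) * b u v
}.

Lemma dual_pair_sym (U V : superVectType K) (b : 'Hom(U, dual V))
    (b' : 'Hom(V, dual U)) : dual_pair b b' -> dual_pair b' b.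
Proof.
case=> bP bP' b0 bC; split=> // i j v u vi uj.
  by move=> ij; rewrite (bC j i) // (b0 j i) ?mulr0 // eq_sym.
by rewrite (bC j i) // andbC mulrA -signr_addb addbb mul1r.
Qed.

Lemma bpair_dpair (P : superVectType K) : dual_pair (bpair P) (dpair P).
Proof.
have b0 i j (x : P) (a : dual P) : x \in gr i -> a \in gr j -> i != j -> a x = 0.
  move=> xi /dual_grP a0 ij; apply: a0.
  by case: i j xi ij => -[].
split; first exact: bpair_perfect; first exact: dpair_perfect.
- by move=> i j x a xi aj ij; rewrite (bpairE xi aj) (b0 i j) // mulr0.
by move=> i j x a xi aj; rewrite (bpairE xi aj) dpairE mulrA -signr_addb addbb mul1r.
Qed.

Section Bilinear.
Variables (U V : superVectType K) (b : 'Hom(U, dual V)).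
Implicit Types (u : U) (v : V).

Lemma pairDl u u' v : b (u + u') v = b u v + b u' v.
Proof. by rewrite linearD add_lfunE. Qed.
Lemma pairNl u v : b (- u) v = - b u v.
Proof. by rewrite linearN opp_lfunE. Qed.
Lemma pairZl c u v : b (c *: u) v = c * b u v.
Proof. by rewrite linearZ scale_lfunE. Qed.
Lemma pair0l v : b 0 v = 0.
Proof. by rewrite linear0 zero_lfunE. Qed.
Lemma pairDr u v v' : b u (v + v') = b u v + b u v'.
Proof. exact: linearD. Qed.
Lemma pairNr u v : b u (- v) = - b u v.
Proof. exact: linearN. Qed.
Lemma pairZr c u v : b u (c *: v) = c * b u v.
Proof. exact: linearZ. Qed.
Lemma pair0r u : b u 0 = 0.
Proof. exact: linear0. Qed.
Definition pairE := (pairDl, pairNl, pairZl, pair0l, pairDr, pairNr, pairZr, pair0r).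

End Bilinear.

Section Pair.
Variables (U V : superVectType K) (b : 'Hom(U, dual V)) (b' : 'Hom(V, dual U)).
Hypothesis bb' : dual_pair b b'.
Implicit Types (u : U) (v : V).

Lemma pair_ext u u' : (forall i v, v \in gr i -> b u v = b u' v) -> u = u'.
Proof.
have /andP[/lker0P bI _] := pair_perfectl bb' => uu'.
exact/bI/lfun_hext.
Qed.

(** The part of [u] of parity [~~ i] pairs to zero with [gr i] because the pairing is even, and with
    [gr (~~ i)] because both [u] and its other part do. Perfectness makes it 0. *)
Lemma pair_gr i u : (forall v, v \in gr (~~ i) -> b u v = 0) -> u \in gr i.
Proof.
move=> u0; rewrite -(hpart_add i u) (_ : hpart (~~ i) u = 0) ?addr0 ?hpart_gr //.
apply: pair_ext => j v vj; rewrite pair0l.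
have [ji|ji] := eqVneq j (~~ i); last first.
  by apply: (pair_even bb' (hpart_gr _ _) vj); rewrite eq_sym.
rewrite -[RHS](u0 v) -?ji // -{2}(hpart_add i u) pairDl ji.
by rewrite (pair_even bb' (hpart_gr i u) vj) ?add0r // ji; case: (i).
Qed.

Definition contractv (W : vectType K) v : 'Hom(tensor U W, W) :=
  contract W (rpair b v).

Lemma contractvE (W : vectType K) v u (w : W) :
  contractv W v (u \ox w) = b u v *: w.
Proof. by rewrite /contractv contractE rpairE. Qed.

(** Perfectness turns every functional on [U] into the pairing with some [v], which is the sum of
    its homogeneous parts. *)
Lemma contractv_sep (W : vectType K) (t : tensor U W) :
  (forall i v, v \in gr i -> contractv W v t = 0) -> t = 0.
Proof.
move=> t0; apply: contract_sep => f.
pose v := ((rpair b)^-1)%VF f.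
have <- : rpair b v = f by exact: rpairK (pair_perfectl bb') _.
suff E : contractv W v = contractv W (hpart true v) + contractv W (hpart false v).
  by rewrite -/(contractv W v) E add_lfunE !(t0 _ _ (hpart_gr _ _)) addr0.
apply: tens_ext => u w; rewrite add_lfunE !contractvE.
by rewrite -scalerDl -pairDr (hpart_add true).
Qed.

End Pair.
End DualPair.

(** Once parities are fixed, the goal and the known identity [E] may differ by a global sign. Both
    are brought to the form [_ = 0] and the two signs are tried in turn. *)
Ltac solve_up_to_sign E :=
  move/eqP: E; rewrite -subr_eq0 => /eqP E;
  apply/eqP; rewrite -subr_eq0; apply/eqP;
  first [refine (etrans _ E); ring
        | have /(congr1 -%R) := E; rewrite oppr0; apply: etrans; ring].

Section VectorEquations.
Variables (K : fieldType) (V : vectType K).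
Implicit Types (u v : V) (f : dual V).

Lemma vec_ext u v : (forall f, f u = f v) -> u = v.
Proof.
move=> uv; apply/eqP; rewrite -subr_eq0; apply/eqP/dual_sep => f.
by rewrite linearB /= uv subrr.
Qed.

Lemma functD f u v : f (u + v) = f u + f v :> K.
Proof. by rewrite linearD. Qed.
Lemma functN f u : f (- u) = - f u :> K.
Proof. by rewrite linearN. Qed.
Lemma functZ f c u : f (c *: u) = c * f u :> K.
Proof. by rewrite linearZ. Qed.
Lemma funct0 f : f 0 = 0 :> K.
Proof. by rewrite linear0. Qed.
Definition functE := (functD, functN, functZ, funct0).

Variables (W : vectType K) (g : 'Hom(V, W)).

Lemma homD u v : g (u + v) = g u + g v. Proof. exact: linearD. Qed.
Lemma homN u : g (- u) = - g u. Proof. exact: linearN. Qed.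
Lemma homZ c u : g (c *: u) = c *: g u. Proof. exact: linearZ. Qed.
Lemma hom0 : g 0 = 0. Proof. exact: linear0. Qed.

End VectorEquations.

(* Reduces an identity between linear combinations of vectors to a scalar one,
   the images of the vectors under a generic functional being the atoms. *)
Ltac vec_scalar :=
  apply: vec_ext; let h := fresh "h" in move=> h;
  repeat first [progress rewrite ?functE
               | rewrite scale_lfunE | rewrite add_lfunE
               | rewrite homZ | rewrite homN | rewrite homD | rewrite hom0].

Ltac sign_ring := rewrite /= ?expr0 ?expr1; ring.

(** * Extensionality on tensors and one-sided actions *)

Section TensorExtensionality.
Variables (K : fieldType) (U V : superVectType K) (W : vectType K).

Lemma tens_hlin_ext (f g : tensor U V -> W) : linear f -> linear g ->
  (forall i j u v, u \in gr i -> v \in gr j -> f (u \ox v) = g (u \ox v)) ->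
  f =1 g.
Proof.
move=> fL gL fg t; rewrite -(linfunE fL) -(linfunE gL).
congr (fun_of_lfun _ t); apply: htens_ext => i j u v ui vj.
by rewrite (linfunE fL) (linfunE gL) (fg i j).
Qed.

Lemma eq_hlift (F G : bool -> bool -> U -> V -> W) :
  (forall i j u v, F i j u v = G i j u v) -> hlift F = hlift G.
Proof.
move=> FG; apply/lfunP=> t; rewrite /hlift !tlift_sum.
apply: eq_bigr => i _; apply: eq_bigr => j _; congr (_ *: _).
by apply: eq_bigr => k _; apply: eq_bigr => l _; rewrite FG.
Qed.

(** Separates a two-sided action such as ad(x) into an unsigned action on the first leg and a signed
    one on the second, which behave differently under contraction. *)
Lemma hlift_addl (f : U -> V -> W) (F : bool -> bool -> U -> V -> W) :
  bilin f -> (forall i j, bilin (F i j)) ->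
  hlift (fun i j u v => f u v + F i j u v) = tlift f + hlift F.
Proof.
move=> fB FB; apply: htens_ext => i j u v ui vj.
rewrite add_lfunE (tliftE fB) (hliftE FB ui vj).
rewrite (hliftE (F := fun i j u v => f u v + F i j u v) _ ui vj) // => k l.
have [fl fr] := fB; have [Fl Fr] := FB k l.
by split=> [z c x y|z c x y] /=; rewrite ?fl ?fr ?Fl ?Fr scalerDr addrACA.
Qed.

End TensorExtensionality.

Section TensorBilinear.
Variables (K : fieldType) (U V U' V' : superVectType K).

Lemma tens_bilinl (f : 'Hom(U, U')) : bilin (fun u (v : V) => f u \ox v).
Proof.
have [tl tr] := tens_bilin U' V.
by split=> [z c x y|z c x y] /=; rewrite ?linearP ?tl ?tr.
Qed.

Lemma tens_bilinr c (g : 'Hom(V, V')) : bilin (fun (u : U) v => c *: (u \ox g v)).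
Proof.
have [tl tr] := tens_bilin U V'.
by split=> [z d x y|z d x y] /=; rewrite ?linearP ?tl ?tr scalerDr !scalerA [c * d]mulrC.
Qed.

Lemma tmapE (f : 'Hom(U, U')) (g : 'Hom(V, V')) u v : tmap f g (u \ox v) = f u \ox g v.
Proof.
have [tl tr] := tens_bilin U' V'.
by rewrite /tmap tliftE //; split=> [z c x y|z c x y] /=; rewrite linearP ?tl ?tr.
Qed.

End TensorBilinear.

Section Swap.
Variables (K : fieldType) (P : superVectType K).

Lemma tswapE i j (x y : P) : x \in gr i -> y \in gr j ->
  tswap P (x \ox y) = (-1) ^+ (i && j) *: (y \ox x).
Proof.
move=> xi yj; rewrite /tswap.
rewrite (hliftE (F := fun i j x y => (-1) ^+ (i && j) *: (y \ox x)) _ xi yj) //.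
move=> k l; have [tl tr] := tens_bilin P P.
by split=> [z c u v|z c u v] /=; rewrite ?tl ?tr scalerDr !scalerA mulrC.
Qed.

Variable r : 'Hom(P, 'End(P)).
Hypothesis rE : even_bilin r.

Definition tens_actr (i : bool) (x : P) : 'End(tensor P P) :=
  hlift (fun k _ y1 y2 => (-1) ^+ (i && k) *: (y1 \ox r x y2)).

Lemma tens_actrE i k x y1 y2 : y1 \in gr k ->
  tens_actr i x (y1 \ox y2) = (-1) ^+ (i && k) *: (y1 \ox r x y2).
Proof.
move=> y1k; rewrite /tens_actr.
rewrite (hliftEl (F := fun k y1 y2 => (-1) ^+ (i && k) *: (y1 \ox r x y2)) _ _ y1k) //.
move=> l; exact: tens_bilinr.
Qed.

(** The sign of moving r(x)u past v is the product of the signs of moving u and x past v; the second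
    of these is the Koszul sign in [tens_actr]. *)
Lemma tswap_actl i x t : x \in gr i ->
  tswap P (tlift (fun y1 y2 => r x y1 \ox y2) t) = tens_actr i x (tswap P t).
Proof.
move=> xi; move: t; apply: tens_hlin_ext => [c t t'|c t t'|j k u v uj vk].
- by rewrite !linearP.
- by rewrite !linearP.
rewrite tliftE; last exact: tens_bilinl.
rewrite (tswapE (rE xi uj) vk) (tswapE uj vk) linearZ /= (tens_actrE _ _ _ vk) scalerA.
by rewrite -signr_addb; congr ((-1) ^+ nat_of_bool _ *: _); case: (i) (j) (k) => -[] [].
Qed.

Lemma tswap_actr i x t : x \in gr i ->
  tswap P (tens_actr i x t) = tlift (fun y1 y2 => r x y1 \ox y2) (tswap P t).
Proof.
move=> xi; move: t; apply: tens_hlin_ext => [c t t'|c t t'|j k u v uj vk].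
- by rewrite !linearP.
- by rewrite !linearP.
rewrite (tens_actrE _ _ _ uj) linearZ /= (tswapE uj (rE xi vk)) (tswapE uj vk) [in RHS]linearZ /=.
rewrite tliftE; last exact: tens_bilinl.
rewrite scalerA.
by rewrite -signr_addb; congr ((-1) ^+ nat_of_bool _ *: _); case: (i) (j) (k) => -[] [].
Qed.

End Swap.

(** * Coadjoint maps and contractions *)

Section Adjoint.
Variables (K : fieldType) (U V : superVectType K) (b : 'Hom(U, dual V)) (b' : 'Hom(V, dual U)).
Hypothesis bb' : dual_pair b b'.
Variables (r : 'Hom(U, 'End(U))).
Hypothesis rE : even_bilin r.
Let b'b := dual_pair_sym bb'.

Lemma coadj_even : even_bilin (coadj b' r).
Proof.
move=> i j x v xi vj; apply: (pair_gr b'b) => w wk.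
rewrite (coadjE (pair_perfectl b'b) r w xi vj).
rewrite (pair_even b'b vj (rE xi wk)) ?mulr0 ?oppr0 //.
by case: (i) (j) => -[].
Qed.

(** Two flips of the pairing leave the sign -(-1)^(|x||u|). Only |u| = |x| + |v| contributes, and
    this substitution removes |u| from the sign, so that the adjoint can pass through the
    contraction of a tensor whose first leg runs over all parities. *)
Lemma pair_adj i j k x u v : x \in gr i -> u \in gr j -> v \in gr k ->
  b (r x u) v = - (-1) ^+ (i (+) (i && k)) * b u (coadj b' r x v).
Proof.
move=> xi uj vk; have [kij|kij] := eqVneq (i (+) j) k; last first.
  rewrite (pair_even bb' (rE xi uj) vk) // (pair_even bb' uj (coadj_even xi vk)) ?mulr0 //.
  by move: kij; case: (i) (j) (k) => -[] [].
have := coadjE (pair_perfectl b'b) r u xi vk.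
rewrite (pair_flip bb' uj (coadj_even xi vk)) (pair_flip bb' (rE xi uj) vk).
rewrite -kij; case: (i) (j) => -[] /=; rewrite ?expr0 ?expr1 => E; solve_up_to_sign E.
Qed.
End Adjoint.

Arguments contractv {K U V} b {W} v.

Section ContractOperations.
Variables (K : fieldType) (U V : superVectType K).
Variables (b : 'Hom(U, dual V)) (b' : 'Hom(V, dual U)).
Hypothesis bb' : dual_pair b b'.

(** On a pure tensor the sign in [tpair] is (-1)^(|u2||v|); only legs with |u2| = |w| contribute,
    which makes it constant. *)
Lemma tpair_contract i j v w t : v \in gr i -> w \in gr j ->
  tpair b t (v \ox w) = (-1) ^+ (i && j) * b (contractv b v t) w.
Proof.
move=> vi wj; move: t.
apply: (@tens_hlin_ext _ _ _ K^o) => [c t t'|c t t'|k l u1 u2 u1k u2l].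
- by rewrite linearP /= add_lfunE scale_lfunE.
- by rewrite linearP /= pairDl pairZl mulrDr mulrCA.
rewrite (tpairE _ _ _ u2l vi) contractvE pairZl.
have [<-|lj] := eqVneq l j; first by rewrite andbC.
by rewrite (pair_even bb' u2l wj lj) !mulr0.
Qed.

Lemma contractv_actl (r : 'Hom(U, 'End(U))) i k x v t : even_bilin r ->
  x \in gr i -> v \in gr k ->
  contractv b v (tlift (fun y1 y2 => r x y1 \ox y2) t : tensor U U) =
  - (-1) ^+ (i (+) (i && k)) *: contractv b (coadj b' r x v) t.
Proof.
move=> rE xi vk; move: t; apply: tens_hlin_ext => [c t t'|c t t'|j l y1 y2 y1j y2l].
- by rewrite !linearP.
- by rewrite !linearP.
rewrite tliftE; last exact: tens_bilinl.
by rewrite !contractvE (pair_adj bb' rE xi y1j vk) scalerA.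
Qed.

(** First legs of parity other than [k] pair to zero with [v], so [e] takes the single value [e k].
    The function [e] stays arbitrary because the compatibility conditions carry different signs. *)
Lemma contractv_actr (r : 'Hom(U, 'End(U))) (e : bool -> K) k x v t : v \in gr k ->
  contractv b v (hlift (fun l _ y1 y2 => e l *: (y1 \ox r x y2)) t : tensor U U) =
  e k *: r x (contractv b v t).
Proof.
move=> vk; move: t; apply: tens_hlin_ext => [c t t'|c t t'|j l y1 y2 y1j y2l].
- by rewrite !linearP.
- by rewrite !linearP.
rewrite (hliftEl (F := fun l y1 y2 => e l *: (y1 \ox r x y2)) _ _ y1j); last first.
  by move=> *; exact: tens_bilinr.
rewrite linearZ /= !contractvE linearZ /= !scalerA.
have [<-|jk] := eqVneq j k; first by rewrite linearZ /= scalerA mulrC.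
by rewrite (pair_even bb' y1j vk jk) mul0r !scale0r linear0 scaler0.
Qed.

Variables (m : 'Hom(V, 'End(V))) (d : 'Hom(U, tensor U U)).
Hypothesis mE : even_bilin m.
Hypothesis md : forall u v w, b u (m v w) = tpair b (d u) (v \ox w).

Lemma pair_contract i j u v w : v \in gr i -> w \in gr j ->
  b (contractv b v (d u)) w = (-1) ^+ (i && j) * b u (m v w).
Proof.
move=> vi wj; rewrite md (tpair_contract _ vi wj).
by rewrite mulrA -signr_addb addbb mul1r.
Qed.

(** The pairing of tensors contributes (-1)^(|v||w|) and the coadjoint map -(-1)^(|v||u|). With |u|
    = |v| + |w| they multiply to -(-1)^|v|, which is free of [u], so [u] need not be homogeneous. *)
Lemma contractv_coadj i v u : v \in gr i ->
  contractv b v (d u) = - (-1) ^+ i *: coadj b m v u.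
Proof.
move=> vi; rewrite -(hpart_sum u) !linear_sum; apply: eq_bigr => k _.
have := hpart_gr k u; set u' := hpart k u => uk.
apply: (pair_ext bb') => j w wj; rewrite (pair_contract _ vi wj) pairZl.
rewrite (coadjE (pair_perfectl bb') _ _ vi uk).
have [kij|kij] := eqVneq k (i (+) j); last first.
  by rewrite (pair_even bb' uk (mE vi wj)) // !mulr0 oppr0 mulr0.
rewrite kij mulNr mulrN opprK mulrA -signr_addb.
by congr ((-1) ^+ nat_of_bool _ * _); case: (i) (j) => -[].
Qed.

End ContractOperations.

(** * Contracting the compatibility conditions *)

Section BialgebraMatched.
Variables (K : fieldType) (U V : superVectType K).
Variables (b : 'Hom(U, dual V)) (b' : 'Hom(V, dual U)).
Hypothesis bb' : dual_pair b b'.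
Variables (br mul : 'Hom(U, 'End(U))) (delta Delta : 'Hom(U, tensor U U)).
Variables (br' mul' : 'Hom(V, 'End(V))).
Hypothesis brE : even_bilin br.
Hypothesis mulE : even_bilin mul.
Hypothesis br'E : even_bilin br'.
Hypothesis mul'E : even_bilin mul'.
Hypothesis brC : forall i j (x y : U), x \in gr i -> y \in gr j ->
    br x y = - ((-1) ^+ (i && j) *: br y x).
Hypothesis mulC : forall i j (x y : U), x \in gr i -> y \in gr j ->
    mul x y = (-1) ^+ (i && j) *: mul y x.
Hypothesis br_delta : forall u v w, b u (br' v w) = tpair b (delta u) (v \ox w).
Hypothesis mul_Delta : forall u v w, b u (mul' v w) = tpair b (Delta u) (v \ox w).
Hypothesis deltaC : forall u, tswap U (delta u) = - delta u.
Hypothesis DeltaC : forall u, tswap U (Delta u) = Delta u.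
Let rho1 := coadj b' br.
Let phi1 := - coadj b' mul.
Let rho2 := coadj b br'.
Let phi2 := - coadj b mul'.

Let cdelta k a u : a \in gr k -> contractv b a (delta u) = - (-1) ^+ k *: rho2 a u.
Proof. exact: (contractv_coadj bb' br'E br_delta). Qed.

Let cDelta k a u : a \in gr k -> contractv b a (Delta u) = (-1) ^+ k *: phi2 a u.
Proof.
move=> ak; rewrite /phi2 !opp_lfunE scalerN -scaleNr; exact: (contractv_coadj bb' mul'E mul_Delta).
Qed.

Let rho1E : even_bilin rho1. Proof. exact: (coadj_even bb' brE). Qed.
Let phi1E : even_bilin phi1.
Proof.
move=> i j x v xi vj; rewrite /phi1 !opp_lfunE rpredN; exact: (coadj_even bb' mulE).
Qed.
Let rho2E : even_bilin rho2. Proof. exact: (coadj_even (dual_pair_sym bb') br'E). Qed.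
Let phi2E : even_bilin phi2.
Proof.
move=> i j x v xi vj; rewrite /phi2 !opp_lfunE rpredN.
exact: (coadj_even (dual_pair_sym bb') mul'E).
Qed.

Let cLl_br i k x a t : x \in gr i -> a \in gr k ->
  contractv b a (tlift (fun y1 y2 => br x y1 \ox y2) t : tensor U U) =
  - (-1) ^+ (i (+) (i && k)) *: contractv b (rho1 x a) t.
Proof. exact: (contractv_actl bb' t brE). Qed.

Let cLl_mul i k x a t : x \in gr i -> a \in gr k ->
  contractv b a (tlift (fun y1 y2 => mul x y1 \ox y2) t : tensor U U) =
  (-1) ^+ (i (+) (i && k)) *: contractv b (phi1 x a) t.
Proof.
move=> xi ak; rewrite (contractv_actl bb' t mulE xi ak).
rewrite /phi1 !opp_lfunE /contractv linearN; move: (coadj _ _ _ _) => w.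
have -> : contract U (- rpair b w) = - contract U (rpair b w).
  by apply: tens_ext => u v; rewrite opp_lfunE !contractE opp_lfunE scaleNr.
by rewrite opp_lfunE scalerN scaleNr.
Qed.

(** The first half of ad(x) moves onto [a] as rho1(x), the second commutes with the contraction. The
    term with ad(y) yields {y, rho2(a)x}, which skew-symmetry turns into the {rho2(a)x, y} of
    (M1). *)
Lemma contract_delta_br i j k x y a : x \in gr i -> y \in gr j -> a \in gr k ->
  contractv b a (delta (br x y) - (tens_ad br i x (delta y) -
     (-1) ^+ (i && j) *: tens_ad br j y (delta x))) =
  - (-1) ^+ k *: (rho2 a (br x y) -
     (br (rho2 a x) y + (-1) ^+ (i && k) *: br x (rho2 a y)
      + (-1) ^+ ((i && j) (+) (j && k)) *: rho2 (rho1 y a) x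
      - (-1) ^+ (i && k) *: rho2 (rho1 x a) y)).
Proof.
move=> xi yj ak; rewrite !linearB linearZ /= (cdelta _ ak).
have ad l z u : z \in gr l -> contractv b a (tens_ad br l z (delta u)) =
    (-1) ^+ (l && k) *: ((-1) ^+ k *: rho2 (rho1 z a) u)
    - (-1) ^+ (l && k) *: ((-1) ^+ k *: br z (rho2 a u)).
  move=> zl; rewrite /tens_ad hlift_addl; [|exact: tens_bilinl|by move=> *; exact: tens_bilinr].
  rewrite add_lfunE linearD /= (cLl_br _ zl ak) (cdelta _ (rho1E zl ak)).
  rewrite (contractv_actr bb' _ _ _ _ ak) (cdelta _ ak).
  by vec_scalar; case: (l) (k) => -[]; sign_ring.
rewrite (ad i) // (ad j) // (brC (rho2E ak xi) yj) {ad}.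
by vec_scalar; case: i xi j yj k ak => xi [] yj [] ak; sign_ring.
Qed.

(** Right multiplication by [y] acts on the second leg alone and without a sign, so it passes
    through the contraction for arbitrary [y]. *)
Lemma contract_Delta_mul i k x y a : x \in gr i -> a \in gr k ->
  contractv b a (Delta (mul x y) -
      (tlift (fun y1 y2 => mul x y1 \ox y2) (Delta y)
      + tlift (fun x1 x2 => x1 \ox mul x2 y) (Delta x))) =
  (-1) ^+ k *: (phi2 a (mul x y) -
      (mul (phi2 a x) y + (-1) ^+ (i && k) *: phi2 (phi1 x a) y)).
Proof.
move=> xi ak; rewrite linearB linearD /= (cDelta _ ak) (cLl_mul _ xi ak).
rewrite (cDelta _ (phi1E xi ak)).
have -> : contractv b a (tlift (fun x1 x2 => x1 \ox mul x2 y) (Delta x)) =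
    mul (contractv b a (Delta x)) y.
  move: (Delta x); apply: tens_hlin_ext => [c t t'|c t t'|l l' u v _ _].
  - by rewrite !linearP.
  - by rewrite !linearP add_lfunE scale_lfunE.
  rewrite tliftE ?contractvE ?linearZ ?scale_lfunE //.
  have [tl tr] := tens_bilin U U.
  by split=> [z c u' v'|z c u' v'] /=; rewrite ?linearP ?add_lfunE ?scale_lfunE ?tl ?tr.
rewrite (cDelta _ ak).
by vec_scalar; case: i xi k ak => xi [] ak; sign_ring.
Qed.

(* The two tensor factors are exchanged first: contracting (f) directly gives the
   terms of the first identity of (M3) with the two dual arguments interchanged. *)
Lemma contract_delta_mul i j k x y a : x \in gr i -> y \in gr j -> a \in gr k ->
  contractv b a (tswap U (delta (mul x y) -
      ((-1) ^+ (i && j) *: tlift (fun x1 x2 => mul y x1 \ox x2) (delta x)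
      + tlift (fun y1 y2 => mul x y1 \ox y2) (delta y)
      + hlift (fun k _ y1 y2 => (-1) ^+ (i && k) *: (y1 \ox br x y2)) (Delta y)
      + hlift (fun k _ x1 x2 =>
          (-1) ^+ ((i && j) (+) (j && k)) *: (x1 \ox br y x2)) (Delta x)))) =
  (-1) ^+ k *: (rho2 a (mul x y) -
      (mul (rho2 a x) y + (-1) ^+ (k && i) *: mul x (rho2 a y)
      - (-1) ^+ (k && i) *: phi2 (rho1 x a) y
      - (-1) ^+ ((k && j) (+) (i && j)) *: phi2 (rho1 y a) x)).
Proof.
move=> xi yj ak.
(* The sign of this term is (-1)^(|x||y|) times the Koszul sign in [tens_actr], so it is an action
   that the swap can exchange. *)
have -> : hlift (fun k _ x1 x2 =>
    (-1) ^+ ((i && j) (+) (j && k)) *: (x1 \ox br y x2)) =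
    (-1) ^+ (i && j) *: tens_actr br j y.
  apply: (@htens_ext K U U) => l l' u v ul _.
  rewrite (hliftEl (F := fun k x1 x2 =>
    (-1) ^+ ((i && j) (+) (j && k)) *: (x1 \ox br y x2)) _ _ ul).
    by rewrite scale_lfunE (tens_actrE _ _ _ _ ul) scalerA -signr_addb.
  by move=> *; exact: tens_bilinr.
rewrite scale_lfunE !(homD, homN, homZ) -/(tens_actr br i x).
rewrite !(tswap_actl mulE _ xi) !(tswap_actl mulE _ yj).
rewrite !(tswap_actr brE _ xi) !(tswap_actr brE _ yj) !deltaC !DeltaC !homN.
rewrite !(contractv_actr bb' mul _ _ _ ak) (cLl_br _ xi ak) (cLl_br _ yj ak).
rewrite (cDelta _ (rho1E xi ak)) (cDelta _ (rho1E yj ak)) !(cdelta _ ak).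
rewrite (mulC (rho2E ak xi) yj).
by vec_scalar; case: i xi j yj k ak => xi [] yj [] ak; sign_ring.
Qed.

(** The common factor is the sign with which {x, phi2(a)y}, the leading term of the second identity
    of (M3), arises from the second leg of Delta(y). *)
Lemma contract_Delta_br i j k x y a : x \in gr i -> y \in gr j -> a \in gr k ->
  contractv b a (Delta (br x y) -
      (tlift (fun y1 y2 => br x y1 \ox y2) (Delta y)
      + hlift (fun k _ y1 y2 => (-1) ^+ (i && k) *: (y1 \ox br x y2)) (Delta y)
      + (-1) ^+ (i && j) *: hlift (fun k _ x1 x2 =>
          mul y x1 \ox x2 - (-1) ^+ (j && k) *: (x1 \ox mul y x2)) (delta x))) =
  - (-1) ^+ (k (+) (i && k)) *: (br x (phi2 a y)
      - (-1) ^+ ((i && k) (+) (i && j) (+) (k && j)) *: rho2 (phi1 y a) x -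
    (phi2 (rho1 x a) y - (-1) ^+ (i && k) *: mul (rho2 a x) y
      + (-1) ^+ (i && k) *: phi2 a (br x y))).
Proof.
move=> xi yj ak.
have -> : hlift (fun k _ x1 x2 =>
    mul y x1 \ox x2 - (-1) ^+ (j && k) *: (x1 \ox mul y x2)) =
    tlift (fun x1 x2 => mul y x1 \ox x2)
    + hlift (fun k _ x1 x2 => - (-1) ^+ (j && k) *: (x1 \ox mul y x2)).
  rewrite -hlift_addl; [|exact: tens_bilinl|by move=> *; exact: tens_bilinr].
  by apply: eq_hlift => *; rewrite scaleNr.
rewrite !(homD, homN, homZ) add_lfunE homD.
rewrite (contractv_actr bb' br (fun l => (-1) ^+ (i && l)) _ _ ak).
rewrite (contractv_actr bb' mul (fun l => - (-1) ^+ (j && l)) _ _ ak).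
rewrite (cLl_br _ xi ak) (cLl_mul _ yj ak) !(cDelta _ ak).
rewrite (cDelta _ (rho1E xi ak)) (cdelta _ (phi1E yj ak)) (cdelta _ ak).
rewrite (mulC (rho2E ak xi) yj).
by vec_scalar; case: i xi j yj k ak => xi [] yj [] ak; sign_ring.
Qed.
End BialgebraMatched.

(** * Triple tensors *)

Section TripleTensor.
Variables (K : fieldType) (P : superVectType K).
Let tl := (tens_bilin P P).1.
Let tr := (tens_bilin P P).2.
Let tl3 := (tens_bilin P (tensor P P)).1.
Let tr3 := (tens_bilin P (tensor P P)).2.

Lemma tens3_hlin_ext (W : vectType K) (f g : tensor P (tensor P P) -> W) :
  linear f -> linear g ->
  (forall i j k x y z, x \in gr i -> y \in gr j -> z \in gr k ->
     f (x \ox (y \ox z)) = g (x \ox (y \ox z))) -> f =1 g.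
Proof.
move=> fL gL fg; apply: tens_hlin_ext => // i _ x t xi _; move: t.
apply: tens_hlin_ext => [c s t|c s t|j k y z yj zk]; last exact: fg xi yj zk.
  by rewrite tr3 fL.
by rewrite tr3 gL.
Qed.

Lemma tassocE (x y z : P) : tassoc P P P ((x \ox y) \ox z) = x \ox (y \ox z).
Proof.
have B (w : P) : bilin (fun u v : P => u \ox (v \ox w)).
  by split=> [v c u u'|u c v v'] /=; rewrite ?tl ?tr3 ?tl3.
rewrite /tassoc tliftE; first by rewrite tliftE.
split=> [w c s t|s c w w'] /=; first by rewrite linearP.
move: s; apply: tens_hlin_ext => [d s t|d s t|i j u v _ _].
- by vec_scalar; ring.
- by vec_scalar; ring.
by rewrite !tliftE // tr tr3.
Qed.

Lemma tassocVE (x y z : P) : tassocV P P P (x \ox (y \ox z)) = (x \ox y) \ox z.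
Proof.
have [sl sr] := tens_bilin (tensor P P) P.
have B (u : P) : bilin (fun v w : P => (u \ox v) \ox w).
  by split=> [w c v v'|v c w w'] /=; rewrite ?tr ?sl ?sr.
rewrite /tassocV tliftE; first by rewrite tliftE.
split=> [s c u u'|u c s t] /=; last by rewrite linearP.
move: s; apply: tens_hlin_ext => [d s t|d s t|i j v w _ _].
- by vec_scalar; ring.
- by vec_scalar; ring.
by rewrite !tliftE // tl sl.
Qed.

Lemma tcycleE i j k (x y z : P) : x \in gr i -> y \in gr j -> z \in gr k ->
  tcycle P (x \ox (y \ox z)) = (-1) ^+ (i && (j (+) k)) *: (y \ox (z \ox x)).
Proof.
move=> xi yj zk; rewrite /tcycle.
have B (u : P) : bilin (fun v w : P => v \ox (w \ox u)).
  by split=> [w c v v'|v c w w'] /=; rewrite ?tl ?tl3 ?tr3.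
have T (u v w : P) : tlift (fun v w => v \ox (w \ox u)) (v \ox w) = v \ox (w \ox u).
  exact: (tliftE (B u)).
have C c : bilin (fun (u : P) (t : tensor P P) => c *: tlift (fun v w => v \ox (w \ox u)) t).
  split=> [s d u u'|u d s t] /=; last by rewrite !linearP.
  move: s; apply: tens_hlin_ext => [e s t|e s t|l m v w _ _].
  - by vec_scalar; ring.
  - by vec_scalar; ring.
  by rewrite !T tr tr3 scalerDr !scalerA mulrC.
rewrite (hliftE (F := fun i j x t =>
  (-1) ^+ (i && j) *: tlift (fun y z => y \ox (z \ox x)) t) _ xi (tens_gr yj zk)) //.
by rewrite T.
Qed.

Lemma tswap12E i j (x y z : P) : x \in gr i -> y \in gr j ->
  tswap12 P (x \ox (y \ox z)) = (-1) ^+ (i && j) *: (y \ox (x \ox z)).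
Proof.
move=> xi yj; rewrite /tswap12 !comp_lfunE tassocVE tmapE id_lfunE (tswapE xi yj).
rewrite -[in RHS]tassocE -linearZ; congr (tassoc P P P _).
by apply/matrixP=> a b; rewrite !mxE linearZ /= mulrA.
Qed.

End TripleTensor.

(** * Coalgebra axioms by duality *)

Section Coalgebra.
Variables (K : fieldType) (U V : superVectType K).
Variables (b : 'Hom(U, dual V)) (b' : 'Hom(V, dual U)).
Hypothesis bb' : dual_pair b b'.

Lemma tens_pair_ext (t t' : tensor U U) :
  (forall i j v w, v \in gr i -> w \in gr j ->
     b (contractv b v t) w = b (contractv b v t') w) -> t = t'.
Proof.
move=> tt'; apply/eqP; rewrite -subr_eq0; apply/eqP/(contractv_sep bb') => i v vi.
by rewrite linearB; apply/eqP; rewrite subr_eq0; apply/eqP/(pair_ext bb') => j w; exact: tt' vi.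
Qed.

Lemma tens3_pair_ext (t t' : tensor U (tensor U U)) :
  (forall i j k v w z, v \in gr i -> w \in gr j -> z \in gr k ->
     b (contractv b w (contractv b v t)) z = b (contractv b w (contractv b v t')) z) ->
  t = t'.
Proof.
move=> tt'; apply/eqP; rewrite -subr_eq0; apply/eqP/(contractv_sep bb') => i v vi.
rewrite linearB; apply/eqP; rewrite subr_eq0; apply/eqP/tens_pair_ext => j k w z wj zk.
exact: tt' vi wj zk.
Qed.

Lemma pair_tswap i j v w t : v \in gr i -> w \in gr j ->
  b (contractv b v (tswap U t)) w = (-1) ^+ (i && j) * b (contractv b w t) v.
Proof.
move=> vi wj; move: t; apply: (@tens_hlin_ext _ _ _ K^o) => [c s t|c s t|k l x y xk yl].
- by rewrite !(pairDl, pairZl, homD, homZ).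
- by rewrite !(pairDl, pairZl, homD, homZ) mulrDr mulrCA.
rewrite (tswapE xk yl) homZ pairZl !contractvE !pairZl.
have [<-|li] := eqVneq l i; last by rewrite (pair_even bb' yl vi li) !(mul0r, mulr0).
have [<-|kj] := eqVneq k j; last by rewrite (pair_even bb' xk wj kj) !(mul0r, mulr0).
by rewrite andbC [b y v * _]mulrC.
Qed.

Lemma contractv_tmapr (d : 'Hom(U, tensor U U)) v (t : tensor U U) :
  contractv b v (tmap \1 d t) = d (contractv b v t).
Proof.
move: t; apply: tens_hlin_ext => [c s t|c s t|k l x y xk yl].
- by rewrite !(homD, homZ).
- by rewrite !(homD, homZ).
by rewrite tmapE !contractvE id_lfunE homZ.
Qed.

(** The map xi puts the legs x1, x2, x3 into the order x2, x3, x1, so [v] and [w] meet the second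
    and third legs and [z] the first; parities of legs then become parities of arguments. *)
Lemma pair_tcycle i j k v w z (t : tensor U (tensor U U)) :
  v \in gr i -> w \in gr j -> z \in gr k ->
  b (contractv b w (contractv b v (tcycle U t))) z =
  (-1) ^+ (k && (i (+) j)) * b (contractv b v (contractv b z t)) w.
Proof.
move=> vi wj zk; move: t.
apply: (@tens3_hlin_ext _ _ K^o) => [c s t|c s t|l m n x1 x2 x3 x1l x2m x3n].
- by rewrite !(pairDl, pairZl, homD, homZ).
- by rewrite !(pairDl, pairZl, homD, homZ) mulrDr mulrCA.
rewrite (tcycleE x1l x2m x3n) !(contractvE, pairZl, homZ).
have [->|li] := eqVneq l k; last by rewrite (pair_even bb' x1l zk li) !(mul0r, mulr0).
have [->|mi] := eqVneq m i; last by rewrite (pair_even bb' x2m vi mi) !(mul0r, mulr0).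
have [->|nj] := eqVneq n j; last by rewrite (pair_even bb' x3n wj nj) !(mul0r, mulr0).
ring.
Qed.

Lemma pair_tswap12 i j v w z (t : tensor U (tensor U U)) :
  v \in gr i -> w \in gr j ->
  b (contractv b w (contractv b v (tswap12 U t))) z =
  (-1) ^+ (i && j) * b (contractv b v (contractv b w t)) z.
Proof.
move=> vi wj; move: t.
apply: (@tens3_hlin_ext _ _ K^o) => [c s t|c s t|l m n x1 x2 x3 x1l x2m x3n].
- by rewrite !(pairDl, pairZl, homD, homZ).
- by rewrite !(pairDl, pairZl, homD, homZ) mulrDr mulrCA.
rewrite (tswap12E _ x1l x2m) !(contractvE, pairZl, homZ).
have [->|li] := eqVneq l j; last by rewrite (pair_even bb' x1l wj li) !(mul0r, mulr0).
have [->|mi] := eqVneq m i; last by rewrite (pair_even bb' x2m vi mi) !(mul0r, mulr0).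
by rewrite andbC; ring.
Qed.

(** Contracting both legs of d(x) against [v] and [w] is, up to the sign of [tpair], the pairing of
    x with m(v, w). *)
Lemma contractv_tassoc (d : 'Hom(U, tensor U U)) (m : 'Hom(V, 'End(V))) i j v w t :
  (forall u v w, b u (m v w) = tpair b (d u) (v \ox w)) ->
  v \in gr i -> w \in gr j ->
  contractv b w (contractv b v (tassoc U U U (tmap d \1 t))) =
  (-1) ^+ (i && j) *: contractv b (m v w) t.
Proof.
move=> md vi wj; move: t.
apply: tens_hlin_ext => [c s t|c s t|k l x y xk yl].
- by rewrite !(homD, homZ).
- by rewrite !(homD, homZ) scalerDr !scalerA mulrC.
rewrite tmapE id_lfunE contractvE scalerA -(pair_contract bb' md _ vi wj).
move: (d x) => s {xk x}; move: s.
have [sl sr] := tens_bilin (tensor U U) U.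
apply: tens_hlin_ext => [c s t|c s t|k' m' x z _ _].
- by rewrite sl !(homD, homZ).
- by rewrite !(pairDl, pairZl, homD, homZ) scalerDl scalerA.
by rewrite tassocE !(contractvE, pairZl, homZ) scalerA.
Qed.

Lemma contractv_gr i k v (t : tensor U U) : v \in gr i -> t \in gr k ->
  contractv b v t \in gr (i (+) k).
Proof.
move=> vi tk; rewrite memv_preim; apply/subvP: t tk; apply/subv_sumP=> l _.
apply/span_subvP=> _ /allpairsP[[x y] /= [/vbasis_mem xl /vbasis_mem yl ->]].
rewrite -memv_preim contractvE.
have [<-|li] := eqVneq l i; first exact: memvZ.
by rewrite (pair_even bb' xl vi li) scale0r mem0v.
Qed.

(** The part s' of d(u) of the wrong parity can only be detected by v, w with |v| + |w| different
    from |u|. There the part s pairs to zero, and so does u with m(v, w). *)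
Lemma dual_comul_even (d : 'Hom(U, tensor U U)) (m : 'Hom(V, 'End(V))) :
  even_bilin m -> (forall u v w, b u (m v w) = tpair b (d u) (v \ox w)) ->
  even_map d.
Proof.
move=> mE md k u uk.
have [s [s' [sk s'k dE]]] : exists s s', [/\ s \in gr k, s' \in gr (~~ k) & d u = s + s'].
  exists (hpart k (d u)), (hpart (~~ k) (d u)).
  by rewrite hpart_add; split=> //; exact: hpart_gr.
suff s'0 : s' = 0 by rewrite dE s'0 addr0.
apply: tens_pair_ext => i j v w vi wj; rewrite hom0 pair0l.
have := contractv_gr vi sk; have := contractv_gr vi s'k.
have := pair_contract bb' md u vi wj; rewrite dE homD pairDl.
move: (contractv b v s) (contractv b v s') => c c' + c'k ck.
have [ij|ij] := eqVneq (i (+) ~~ k) j; last by rewrite (pair_even bb' c'k wj ij).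
have cw : b c w = 0 by apply: (pair_even bb' ck wj); rewrite -ij; case: (i) (k) => -[].
rewrite cw add0r => ->.
rewrite (pair_even bb' uk (mE _ _ _ _ vi wj)) ?mulr0 //.
by rewrite -ij; case: (i) (k) => -[].
Qed.

Variables (br mul : 'Hom(V, 'End(V))) (delta Delta : 'Hom(U, tensor U U)).
Hypothesis poissonV : poisson_superalgebra br mul.
Hypothesis br_delta : forall u v w, b u (br v w) = tpair b (delta u) (v \ox w).
Hypothesis mul_Delta : forall u v w, b u (mul v w) = tpair b (Delta u) (v \ox w).
Let brE := br_even poissonV.
Let mulE := mul_even poissonV.

Lemma tswap_delta u : tswap U (delta u) = - delta u.
Proof.
apply: tens_pair_ext => i j v w vi wj; rewrite (pair_tswap _ vi wj) homN pairNl.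
rewrite (pair_contract bb' br_delta _ wj vi) (pair_contract bb' br_delta _ vi wj).
rewrite (br_skew poissonV wj vi) !pairE.
by case: (i) (j) => -[]; sign_ring.
Qed.

Lemma tswap_Delta u : tswap U (Delta u) = Delta u.
Proof.
apply: tens_pair_ext => i j v w vi wj; rewrite (pair_tswap _ vi wj).
rewrite (pair_contract bb' mul_Delta _ wj vi) (pair_contract bb' mul_Delta _ vi wj).
rewrite (mul_comm poissonV wj vi) !pairE.
by case: (i) (j) => -[]; sign_ring.
Qed.

Let pair_tmap2 (d d' : 'Hom(U, tensor U U)) (m m' : 'Hom(V, 'End(V))) i j k v w z u :
  even_bilin m' ->
  (forall u v w, b u (m v w) = tpair b (d u) (v \ox w)) ->
  (forall u v w, b u (m' v w) = tpair b (d' u) (v \ox w)) ->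
  v \in gr i -> w \in gr j -> z \in gr k ->
  b (contractv b w (contractv b v (tmap \1 d' (d u)))) z =
  (-1) ^+ (j && k) * ((-1) ^+ (i && (j (+) k)) * b u (m v (m' w z))).
Proof.
move=> m'E md md' vi wj zk.
rewrite contractv_tmapr (pair_contract bb' md' _ wj zk).
by rewrite (pair_contract bb' md _ vi (m'E _ _ _ _ wj zk)).
Qed.

Let pair_tassoc2 (d d' : 'Hom(U, tensor U U)) (m m' : 'Hom(V, 'End(V))) i j k v w z u :
  even_bilin m' ->
  (forall u v w, b u (m v w) = tpair b (d u) (v \ox w)) ->
  (forall u v w, b u (m' v w) = tpair b (d' u) (v \ox w)) ->
  v \in gr i -> w \in gr j -> z \in gr k ->
  b (contractv b w (contractv b v (tassoc U U U (tmap d' \1 (d u))))) z =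
  (-1) ^+ (i && j) * ((-1) ^+ ((i (+) j) && k) * b u (m (m' v w) z)).
Proof.
move=> m'E md md' vi wj zk.
by rewrite (contractv_tassoc _ md' vi wj) pairZl (pair_contract bb' md _ (m'E _ _ _ _ vi wj) zk).
Qed.

(** Contracted against v, w, z, the identity, xi and its square give the iterated brackets in the
    three cyclic orders, which are the terms of the Jacobi identity in [V]. *)
Lemma dual_delta_jacobi :
  ((\1 + tcycle U + (tcycle U \o tcycle U)) \o (tmap \1 delta \o delta))%VF = 0.
Proof.
apply/lfunP=> u; rewrite zero_lfunE !comp_lfunE !add_lfunE id_lfunE comp_lfunE.
apply: tens3_pair_ext => i j k v w z vi wj zk; rewrite !(pairDl, pair0l, homD, hom0).
rewrite (pair_tcycle _ vi wj zk) (pair_tcycle _ vi wj zk) (pair_tcycle _ zk vi wj).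
rewrite (pair_tmap2 _ brE br_delta br_delta vi wj zk).
rewrite (pair_tmap2 _ brE br_delta br_delta wj zk vi).
rewrite (pair_tmap2 _ brE br_delta br_delta zk vi wj).
have := congr1 (b u) (br_jacobi poissonV vi wj zk); rewrite !pairE.
by case: (i) (j) (k) => -[] []; rewrite /= ?expr0 ?expr1 => J; solve_up_to_sign J.
Qed.

Lemma dual_Delta_assoc :
  (tmap \1 Delta \o Delta)%VF = (tassoc U U U \o (tmap Delta \1 \o Delta))%VF.
Proof.
apply/lfunP=> u; rewrite !comp_lfunE.
apply: tens3_pair_ext => i j k v w z vi wj zk.
rewrite (pair_tmap2 _ mulE mul_Delta mul_Delta vi wj zk).
rewrite (pair_tassoc2 _ mulE mul_Delta mul_Delta vi wj zk) (mul_assoc poissonV).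
by case: (i) (j) (k) => -[] []; sign_ring.
Qed.

(** The three terms contract to the pairings with {v, wz}, {v, w}z and w{v, z}, up to signs. *)
Lemma dual_delta_Delta_leibniz :
  (tmap \1 Delta \o delta)%VF =
    (tassoc U U U \o (tmap delta \1 \o Delta))%VF
    + (tswap12 U \o (tmap \1 delta \o Delta))%VF.
Proof.
(* From here [tswap12], itself a composition, enters only through its effect on contractions. *)
have S := pair_tswap12; move: (tswap12 U) S => s12 S.
apply/lfunP=> u; rewrite add_lfunE !comp_lfunE.
apply: tens3_pair_ext => i j k v w z vi wj zk; rewrite !(pairDl, homD).
rewrite (pair_tmap2 _ mulE br_delta mul_Delta vi wj zk).
rewrite (pair_tassoc2 _ brE mul_Delta br_delta vi wj zk).
rewrite (S _ _ _ _ _ _ vi wj) (pair_tmap2 _ brE mul_Delta br_delta wj vi zk).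
rewrite (br_leibniz poissonV _ vi wj) !pairE.
by case: (i) (j) (k) => -[] []; sign_ring.
Qed.

End Coalgebra.

Section Signs.
Variables (K : fieldType) (W : vectType K).
Implicit Types u v : W.

Lemma sign_scaler_inj (n : bool) u v : 0 = (-1) ^+ n *: (u - v) :> W -> u = v.
Proof.
move/esym/eqP; rewrite scaler_eq0 signr_eq0 subr_eq0; exact/eqP.
Qed.

Lemma Nsign_scaler_inj (n : bool) u v : 0 = - (-1) ^+ n *: (u - v) :> W -> u = v.
Proof. by move/eqP; rewrite scaleNr eq_sym oppr_eq0 eq_sym => /eqP /sign_scaler_inj. Qed.

End Signs.

Lemma sub_scale_lfunE (K : fieldType) (U W : vectType K) c (f g : 'Hom(U, W)) u :
  (f - c *: g) u = f u - c *: g u.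
Proof. by rewrite add_lfunE opp_lfunE scale_lfunE. Qed.

Lemma tswapK (K : fieldType) (P : superVectType K) : cancel (tswap P) (tswap P).
Proof.
move=> t; rewrite -comp_lfunE -[RHS]id_lfunE; congr (fun_of_lfun _ t).
apply: htens_ext => i j x y xi yj.
rewrite comp_lfunE id_lfunE (tswapE xi yj) homZ (tswapE yj xi) scalerA andbC.
by rewrite -signr_addb addbb scale1r.
Qed.

Section PoissonIdentities.
Variables (K : fieldType) (P : superVectType K) (br mul : 'Hom(P, 'End(P))).
Hypothesis PA : poisson_superalgebra br mul.

(** This form of the Jacobi identity, adjoint maps being a representation, is the one that dualizes
    to (R) and whose [U]-component gives (M1). *)
Lemma br_ad i j k (x y z : P) : x \in gr i -> y \in gr j -> z \in gr k ->
  br (br x y) z = br x (br y z) - (-1) ^+ (i && j) *: br y (br x z).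
Proof.
move=> xi yj zk; apply: vec_ext => f.
have := congr1 f (br_jacobi PA xi yj zk).
rewrite (br_skew PA (br_even PA xi yj) zk) (br_skew PA xi zk).
rewrite !(functE, homN, homZ).
by case: (i) (j) (k) => -[] []; rewrite /= ?expr0 ?expr1 => J; solve_up_to_sign J.
Qed.

End PoissonIdentities.

(** * The coadjoint maps form a representation *)

Section Representation.
Variables (K : fieldType) (U V : superVectType K).
Variables (b : 'Hom(U, dual V)) (b' : 'Hom(V, dual U)).
Hypothesis bb' : dual_pair b b'.
Variables (br mul : 'Hom(U, 'End(U))).
Hypothesis PA : poisson_superalgebra br mul.
Let rho := coadj b' br.
Let phi := - coadj b' mul.
Let b'b := dual_pair_sym bb'.
Let brE := br_even PA.
Let mulE := mul_even PA.

Let pair_rho i k x v z : x \in gr i -> v \in gr k ->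
  b' (rho x v) z = - ((-1) ^+ (i && k) * b' v (br x z)).
Proof. exact: (coadjE (pair_perfectl b'b)). Qed.

Let pair_phi i k x v z : x \in gr i -> v \in gr k ->
  b' (phi x v) z = (-1) ^+ (i && k) * b' v (mul x z).
Proof.
move=> xi vk; rewrite /phi !opp_lfunE pairNl.
by rewrite (coadjE (pair_perfectl b'b) _ _ xi vk) opprK.
Qed.

Lemma coadj_phi_even : even_bilin phi.
Proof.
move=> i j x v xi vj; rewrite /phi !opp_lfunE rpredN; exact: (coadj_even bb' mulE).
Qed.
Let rhoE : even_bilin rho := coadj_even bb' brE.
Let phiE := coadj_phi_even.

Lemma coadj_rho_br i j (x y : U) : x \in gr i -> y \in gr j ->
  rho (br x y) = (rho x \o rho y)%VF - (-1) ^+ (i && j) *: (rho y \o rho x)%VF.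
Proof.
move=> xi yj; apply: lfun_hext => k a ak; apply: (pair_ext b'b) => l z zl.
rewrite sub_scale_lfunE !comp_lfunE pairDl pairNl pairZl.
rewrite (pair_rho _ (brE xi yj) ak) (pair_rho _ xi (rhoE yj ak)) (pair_rho _ yj (rhoE xi ak)).
rewrite (pair_rho _ xi ak) (pair_rho _ yj ak) (br_ad PA xi yj zl) !pairE.
by case: (i) (j) (k) => -[] []; sign_ring.
Qed.

(** Dualizing reverses the composition, so the pairing produces y(xz), which is (xy)z up to sign by
    supercommutativity and associativity. *)
Lemma coadj_phi_mul (x y : U) : phi (mul x y) = (phi x \o phi y)%VF.
Proof.
rewrite -(hpart_add true x) -(hpart_add true y).
have H i j : phi (mul (hpart i x) (hpart j y)) = (phi (hpart i x) \o phi (hpart j y))%VF.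
  have := hpart_gr i x; have := hpart_gr j y; move: (hpart i x) (hpart j y) => x' y' yj xi.
  apply: lfun_hext => k a ak; apply: (pair_ext b'b) => l z zl; rewrite comp_lfunE.
  rewrite (pair_phi _ (mulE xi yj) ak) (pair_phi _ xi (phiE yj ak)) (pair_phi _ yj ak).
  rewrite (mul_comm PA xi yj) homZ scale_lfunE -(mul_assoc PA) pairZr.
  by case: (i) (j) (k) => -[] []; sign_ring.
rewrite [mul (_ + _)]homD add_lfunE !homD !H !comp_lfunDl !comp_lfunDr.
by rewrite !addrA.
Qed.

(** Against [z] the right side gives {y, xz} and {x, yz} up to signs. In their Leibniz expansions
    the terms {y, x}z and {x, y}z cancel by skew-symmetry, and the rest is the expansion of {xy,
    z}. *)
Lemma coadj_rho_mul i j (x y : U) : x \in gr i -> y \in gr j ->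
  rho (mul x y) = (phi x \o rho y)%VF + (-1) ^+ (i && j) *: (phi y \o rho x)%VF.
Proof.
move=> xi yj; apply: lfun_hext => k a ak; apply: (pair_ext b'b) => l z zl.
rewrite add_lfunE scale_lfunE !comp_lfunE pairDl pairZl.
rewrite (pair_rho _ (mulE xi yj) ak) (pair_phi _ xi (rhoE yj ak)) (pair_phi _ yj (rhoE xi ak)).
rewrite (pair_rho _ xi ak) (pair_rho _ yj ak).
rewrite (br_skew PA (mulE xi yj) zl) (br_leibniz PA _ zl xi).
rewrite (br_leibniz PA _ yj xi) (br_leibniz PA _ xi yj).
rewrite (br_skew PA zl xi) (br_skew PA zl yj) (br_skew PA yj xi).
rewrite !(pairNr, pairZr, pairDr, homN, homZ, opp_lfunE, scale_lfunE).
rewrite (mul_comm PA (brE xi zl) yj) !pairE.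
by case: (i) (j) (k) (l) => -[] [] []; sign_ring.
Qed.

Lemma coadj_phi_br i j (x y : U) : x \in gr i -> y \in gr j ->
  phi (br x y) = (rho x \o phi y)%VF - (-1) ^+ (i && j) *: (phi y \o rho x)%VF.
Proof.
move=> xi yj; apply: lfun_hext => k a ak; apply: (pair_ext b'b) => l z zl.
rewrite sub_scale_lfunE !comp_lfunE pairDl pairNl pairZl.
rewrite (pair_phi _ (brE xi yj) ak) (pair_rho _ xi (phiE yj ak)) (pair_phi _ yj (rhoE xi ak)).
rewrite (pair_rho _ xi ak) (pair_phi _ yj ak) (br_leibniz PA _ xi yj) !pairE.
by case: (i) (j) (k) => -[] []; sign_ring.
Qed.

End Representation.

(** * Bialgebras and halves of matched pairs *)

Section BialgebraMatchedHalf.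
Variables (K : fieldType) (U V : superVectType K).
Variables (b : 'Hom(U, dual V)) (b' : 'Hom(V, dual U)).
Hypothesis bb' : dual_pair b b'.
Variables (br1 mul1 : 'Hom(U, 'End(U))) (delta Delta : 'Hom(U, tensor U U)).
Variables (br2 mul2 : 'Hom(V, 'End(V))).
Hypothesis PU : poisson_superalgebra br1 mul1.
Hypothesis PV : poisson_superalgebra br2 mul2.
Hypothesis br_delta : forall u v w, b u (br2 v w) = tpair b (delta u) (v \ox w).
Hypothesis mul_Delta : forall u v w, b u (mul2 v w) = tpair b (Delta u) (v \ox w).
Let rho1 := coadj b' br1.
Let phi1 := - coadj b' mul1.
Let rho2 := coadj b br2.
Let phi2 := - coadj b mul2.
Let br1E := br_even PU.
Let mul1E := mul_even PU.
Let br2E := br_even PV.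
Let mul2E := mul_even PV.
Let deltaC := tswap_delta bb' PV br_delta.
Let DeltaC := tswap_Delta bb' PV mul_Delta.

Let C_br := contract_delta_br bb' br1E br2E (br_skew PU) br_delta.
Let C_mul := contract_Delta_mul bb' mul1E mul2E mul_Delta.
Let C_leib1 := contract_delta_mul bb' br1E mul1E br2E mul2E (mul_comm PU)
  br_delta mul_Delta deltaC DeltaC.
Let C_leib2 := contract_Delta_br bb' br1E mul1E br2E mul2E (mul_comm PU)
  br_delta mul_Delta.

Lemma matched_half_of_bialgebra :
  poisson_superbialgebra br1 mul1 delta Delta ->
  matched_pair_half br1 mul1 rho1 phi1 rho2 phi2.
Proof.
move=> bi; split.
- exact: (coadj_even bb' br1E).
- exact: (coadj_phi_even bb' PU).
- exact: (coadj_rho_br bb' PU).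
- exact: (coadj_phi_mul bb' PU).
- exact: (coadj_rho_mul bb' PU).
- exact: (coadj_phi_br bb' PU).
- move=> i j k x y a xi yj ak; have := C_br xi yj ak.
  by rewrite (delta_br bi xi yj) subrr hom0 => /Nsign_scaler_inj.
- move=> i k x y a xi ak; have := C_mul y xi ak.
  by rewrite (Delta_mul bi x y) subrr hom0 => /sign_scaler_inj.
- move=> i j k x y a xi yj ak; have := C_leib1 xi yj ak.
  by rewrite (delta_mul bi xi yj) subrr !hom0 => /sign_scaler_inj.
move=> i j k x y a xi yj ak; have := C_leib2 xi yj ak.
by rewrite (Delta_br bi xi yj) subrr hom0 => /Nsign_scaler_inj.
Qed.

Lemma bialgebra_of_matched_half :
  matched_pair_half br1 mul1 rho1 phi1 rho2 phi2 ->
  poisson_superbialgebra br1 mul1 delta Delta.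
Proof.
move=> mh; split=> //.
- exact: (dual_comul_even bb' br2E br_delta).
- exact: (dual_comul_even bb' mul2E mul_Delta).
- by apply/lfunP=> u; rewrite comp_lfunE opp_lfunE deltaC.
- exact: (dual_delta_jacobi bb' PV br_delta).
- by apply/lfunP=> u; rewrite comp_lfunE DeltaC.
- exact: (dual_Delta_assoc bb' PV mul_Delta).
- exact: (dual_delta_Delta_leibniz bb' PV br_delta mul_Delta).
- move=> i j x y xi yj; apply/eqP; rewrite -subr_eq0; apply/eqP/(contractv_sep bb') => k a ak.
  by rewrite (C_br xi yj ak) (matched_br mh xi yj ak) subrr scaler0.
(* Condition (e) is stated for all vectors, the contraction for homogeneous [x]; both sides are
   additive in [x]. *)
- move=> x y; have H i : Delta (mul1 (hpart i x) y) =
      tlift (fun y1 y2 => mul1 (hpart i x) y1 \ox y2) (Delta y)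
      + tlift (fun x1 x2 => x1 \ox mul1 x2 y) (Delta (hpart i x)).
    apply/eqP; rewrite -subr_eq0; apply/eqP/(contractv_sep bb') => k a ak.
    by rewrite (C_mul y (hpart_gr i x) ak) (matched_mul mh _ (hpart_gr i x) ak) subrr scaler0.
  rewrite -(hpart_add true x); move: (hpart true x) (H true) (hpart (~~ true) x) (H (~~ true)).
  move=> x1 H1 x2 H2; rewrite !homD add_lfunE homD H1 H2 addrACA; congr (_ + _).
  move: (Delta y); apply: tens_hlin_ext => [c s t|c s t|i j u v _ _].
  + by rewrite !(homD, homZ) scalerDr addrACA.
  + by rewrite !(homD, homZ).
  rewrite !tliftE; try exact: tens_bilinl.
  by rewrite add_lfunE; have := (tens_bilin U U).1 v 1 (mul1 x1 u) (mul1 x2 u); rewrite !scale1r.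
(* The first identity of (M3) controls the swapped difference; the swap is an involution, so nothing
   is lost. *)
- move=> i j x y xi yj; apply/eqP; rewrite -subr_eq0; apply/eqP.
  apply: (can_inj (@tswapK _ U)); rewrite hom0; apply: (contractv_sep bb') => k a ak.
  by rewrite (C_leib1 xi yj ak) (matched_leibniz1 mh xi yj ak) subrr scaler0.
move=> i j x y xi yj; apply/eqP; rewrite -subr_eq0; apply/eqP/(contractv_sep bb') => k a ak.
by rewrite (C_leib2 xi yj ak) (matched_leibniz2 mh xi yj ak) subrr scaler0.
Qed.

End BialgebraMatchedHalf.

(** * Operations on a direct sum *)

Section Double.
Variables (K : fieldType) (U V D : superVectType K).

(** Describing the direct sum by maps instead of a product type allows the two summands to be
    exchanged. *)
Record biproduct (f : 'Hom(U, D)) (g : 'Hom(V, D)) (p : 'Hom(D, U)) (q : 'Hom(D, V)) : Prop := {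
  proj_injl : forall x, p (f x) = x;
  proj_injr : forall a, q (g a) = a;
  projl_injr : forall a, p (g a) = 0;
  projr_injl : forall x, q (f x) = 0;
  inj_proj : forall w, f (p w) + g (q w) = w;
  injl_even : even_map f;
  injr_even : even_map g;
  projl_even : even_map p;
  projr_even : even_map q
}.

Variables (f : 'Hom(U, D)) (g : 'Hom(V, D)).

(** With [e = -1] this is the bracket of a matched pair, {x, a} = rho1(x)a - (-1)^(|x||a|) rho2(a)x,
    and with [e = 1] its product. The last field is the third one read through [e]-commutativity,
    which keeps the record symmetric. *)
Record cross_op (e : K) (op : 'Hom(D, 'End(D))) (m1 : 'Hom(U, 'End(U)))
    (m2 : 'Hom(V, 'End(V))) (r1 : 'Hom(U, 'End(V))) (r2 : 'Hom(V, 'End(U))) : Prop := {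
  cross_ll : forall x y, op (f x) (f y) = f (m1 x y);
  cross_rr : forall a c, op (g a) (g c) = g (m2 a c);
  cross_lr : forall i j x a, x \in gr i -> a \in gr j ->
    op (f x) (g a) = g (r1 x a) + (e * (-1) ^+ (i && j)) *: f (r2 a x);
  cross_rl : forall i j x a, x \in gr i -> a \in gr j ->
    op (g a) (f x) = f (r2 a x) + (e * (-1) ^+ (i && j)) *: g (r1 x a)
}.

End Double.

Lemma biproduct_sym (K : fieldType) (U V D : superVectType K) (f : 'Hom(U, D))
    (g : 'Hom(V, D)) p q : biproduct f g p q -> biproduct g f q p.
Proof. by case=> *; split=> // w; rewrite addrC. Qed.

Lemma cross_op_sym (K : fieldType) (U V D : superVectType K) (f : 'Hom(U, D))
    (g : 'Hom(V, D)) e op m1 m2 r1 r2 :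
  cross_op f g e op m1 m2 r1 r2 -> cross_op g f e op m2 m1 r2 r1.
Proof.
case=> ll rr lr rl; split=> // i j a x ai xj.
  by rewrite (rl _ _ _ _ xj ai) andbC.
by rewrite (lr _ _ _ _ xj ai) andbC.
Qed.

(** * Mixed Poisson identities *)

Section CrossIdentities.
Variables (K : fieldType) (U V D : superVectType K).
Variables (f : 'Hom(U, D)) (g : 'Hom(V, D)) (p : 'Hom(D, U)) (q : 'Hom(D, V)).
Hypothesis bp : biproduct f g p q.
Variables (br1 mul1 : 'Hom(U, 'End(U))) (br2 mul2 : 'Hom(V, 'End(V))).
Variables (rho1 phi1 : 'Hom(U, 'End(V))) (rho2 phi2 : 'Hom(V, 'End(U))).
Variables (br mul : 'Hom(D, 'End(D))).
Hypothesis Cbr : cross_op f g (-1) br br1 br2 rho1 rho2.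
Hypothesis Cmul : cross_op f g 1 mul mul1 mul2 phi1 phi2.
Hypothesis PU : poisson_superalgebra br1 mul1.
Hypothesis rho1E : even_bilin rho1.
Hypothesis phi1E : even_bilin phi1.
Hypothesis rho2E : even_bilin rho2.
Hypothesis phi2E : even_bilin phi2.

Let crossR i j x a (xi : x \in gr i) (aj : a \in gr j) :=
  (cross_lr Cbr xi aj, cross_rl Cbr xi aj, cross_lr Cmul xi aj, cross_rl Cmul xi aj).

Section Homogeneous.
Variables (i j k : bool) (x y : U) (a : V).
Hypotheses (xi : x \in gr i) (yj : y \in gr j) (ak : a \in gr k).
Let fx := injl_even bp xi.
Let fy := injl_even bp yj.
Let ga := injr_even bp ak.
Let bxy := br_even PU xi yj.
Let mxy := mul_even PU xi yj.
Let rx := rho1E xi ak.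
Let ry := rho1E yj ak.
Let px := phi1E xi ak.
Let py := phi1E yj ak.
Let rax := rho2E ak xi.

Ltac cross_expand :=
  rewrite ?(crossR xi ak, crossR yj ak, crossR bxy ak, crossR mxy ak,
    cross_ll Cbr, cross_ll Cmul);
  rewrite ?(homD, homN, homZ, add_lfunE, scale_lfunE);
  rewrite ?(crossR xi ry, crossR yj rx, crossR xi py, crossR yj px,
    cross_ll Cbr, cross_ll Cmul).

Section Components.
Hypothesis PD : poisson_superalgebra br mul.

(** The projection [p] keeps the [U]-component of a Poisson axiom on [D]; up to a sign depending on
    the parities it is the wanted identity. *)
Ltac compare_components E :=
  move/(congr1 p): E; cross_expand;
  rewrite ?(homD, homN, homZ) ?(proj_injl bp) ?(projl_injr bp) => E;
  apply: vec_ext => h; move/(congr1 h): E; rewrite !functE;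
  case: (i) (j) (k) => -[] []; rewrite /= ?expr0 ?expr1 => E; solve_up_to_sign E.

Lemma cross_matched_br : rho2 a (br1 x y) =
  br1 (rho2 a x) y + (-1) ^+ (i && k) *: br1 x (rho2 a y)
  + (-1) ^+ ((i && j) (+) (j && k)) *: rho2 (rho1 y a) x
  - (-1) ^+ (i && k) *: rho2 (rho1 x a) y.
Proof.
have E := br_ad PD ga fx fy.
compare_components E.
Qed.

Lemma cross_matched_mul : phi2 a (mul1 x y) =
  mul1 (phi2 a x) y + (-1) ^+ (i && k) *: phi2 (phi1 x a) y.
Proof.
have E := mul_assoc PD (g a) (f x) (f y).
compare_components E.
Qed.

Lemma cross_matched_leibniz1 : rho2 a (mul1 x y) =
  mul1 (rho2 a x) y + (-1) ^+ (k && i) *: mul1 x (rho2 a y)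
  - (-1) ^+ (k && i) *: phi2 (rho1 x a) y
  - (-1) ^+ ((k && j) (+) (i && j)) *: phi2 (rho1 y a) x.
Proof.
have E := br_leibniz PD (f y) ga fx.
compare_components E.
Qed.

Lemma cross_matched_leibniz2 : br1 x (phi2 a y)
    - (-1) ^+ ((i && k) (+) (i && j) (+) (k && j)) *: rho2 (phi1 y a) x =
  phi2 (rho1 x a) y - (-1) ^+ (i && k) *: mul1 (rho2 a x) y
    + (-1) ^+ (i && k) *: phi2 a (br1 x y).
Proof.
have E := br_leibniz PD (f y) fx ga.
compare_components E.
Qed.

End Components.

Section Identities.
Hypothesis mh : matched_pair_half br1 mul1 rho1 phi1 rho2 phi2.

(** The [V]-component is the condition of (R) on rho1 of a bracket, the [U]-component is (M1). *)
Lemma cross_jacobi :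
  (-1) ^+ (i && k) *: br (f x) (br (f y) (g a))
  + (-1) ^+ (k && j) *: br (g a) (br (f x) (f y))
  + (-1) ^+ (j && i) *: br (f y) (br (g a) (f x)) = 0.
Proof.
cross_expand; rewrite (matched_br mh xi yj ak) (rho_br mh xi yj).
rewrite sub_scale_lfunE !comp_lfunE (br_skew PU yj rax).
by vec_scalar; case: (i) (j) (k) => -[] []; sign_ring.
Qed.

(** The [V]-component is the condition on phi1 of a bracket, the [U]-component the second identity
    of (M3). The other order of [f y] and [g a] rests on the same two conditions. *)
Lemma cross_leibniz_llr :
  br (f x) (mul (f y) (g a)) =
  mul (br (f x) (f y)) (g a) + (-1) ^+ (i && j) *: mul (f y) (br (f x) (g a)).
Proof.
cross_expand; rewrite (phi_br mh xi yj) sub_scale_lfunE !comp_lfunE (mul_comm PU yj rax).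
apply: vec_ext => h; have := congr1 (fun u => h (f u)) (matched_leibniz2 mh xi yj ak).
rewrite !(functE, homD, homN, homZ).
by case: (i) (j) (k) => -[] []; rewrite /= ?expr0 ?expr1 => E; solve_up_to_sign E.
Qed.

Lemma cross_leibniz_lrl :
  br (f x) (mul (g a) (f y)) =
  mul (br (f x) (g a)) (f y) + (-1) ^+ (i && k) *: mul (g a) (br (f x) (f y)).
Proof.
cross_expand; rewrite (phi_br mh xi yj) sub_scale_lfunE !comp_lfunE.
apply: vec_ext => h; have := congr1 (fun u => h (f u)) (matched_leibniz2 mh xi yj ak).
rewrite !(functE, homD, homN, homZ).
by case: (i) (j) (k) => -[] []; rewrite /= ?expr0 ?expr1 => E; solve_up_to_sign E.
Qed.

(** The [V]-component is the condition on rho1 of a product, the [U]-component the first identity of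
    (M3). *)
Lemma cross_leibniz_rll :
  br (g a) (mul (f x) (f y)) =
  mul (br (g a) (f x)) (f y) + (-1) ^+ (k && i) *: mul (f x) (br (g a) (f y)).
Proof.
cross_expand; rewrite (matched_leibniz1 mh xi yj ak) (rho_mul mh xi yj).
rewrite add_lfunE scale_lfunE !comp_lfunE.
by vec_scalar; case: (i) (j) (k) => -[] []; sign_ring.
Qed.

Lemma cross_assoc_rll : mul (g a) (mul (f x) (f y)) = mul (mul (g a) (f x)) (f y).
Proof.
(* The [V]-component has phi1(y) and phi1(x) in the order opposite to (R); as phi1 is
   multiplicative, supercommutativity of the product passes to these operators. *)
have C : phi1 y (phi1 x a) = (-1) ^+ (i && j) *: phi1 x (phi1 y a).
  rewrite -[LHS]comp_lfunE -(phi_mul mh) (mul_comm PU yj xi) homZ scale_lfunE.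
  by rewrite (phi_mul mh) comp_lfunE andbC.
cross_expand; rewrite (matched_mul mh _ xi ak) (phi_mul mh) comp_lfunE C.
by vec_scalar; case: (i) (j) (k) => -[] []; sign_ring.
Qed.

End Identities.
End Homogeneous.
End CrossIdentities.

Section AdditiveExtensionality.
Variables (K : fieldType) (U V D : superVectType K) (W : zmodType).
Variables (f : 'Hom(U, D)) (g : 'Hom(V, D)) (p : 'Hom(D, U)) (q : 'Hom(D, V)).
Hypothesis bp : biproduct f g p q.
Variables T T' : D -> W.
Hypothesis TD : {morph T : w w' / w + w'}.
Hypothesis TD' : {morph T' : w w' / w + w'}.

(** Asking only for additivity lets multilinear identities be reduced to the summands one argument
    at a time. *)
Lemma biproduct_ext i :
  (forall x, x \in gr i -> T (f x) = T' (f x)) ->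
  (forall a, a \in gr i -> T (g a) = T' (g a)) ->
  forall w, w \in gr i -> T w = T' w.
Proof.
move=> Tf Tg w wi; rewrite -(inj_proj bp w) TD TD'.
by rewrite Tf ?Tg //; [exact: (projr_even bp)|exact: (projl_even bp)].
Qed.

Lemma hpart_ext : (forall i w, w \in gr i -> T w = T' w) -> forall w, T w = T' w.
Proof.
move=> TT' w; rewrite -(hpart_add true w) TD TD'.
by rewrite !(TT' _ _ (hpart_gr _ _)).
Qed.

End AdditiveExtensionality.

Section CrossOperation.
Variables (K : fieldType) (U V D : superVectType K).
Variables (f : 'Hom(U, D)) (g : 'Hom(V, D)) (p : 'Hom(D, U)) (q : 'Hom(D, V)).
Hypothesis bp : biproduct f g p q.
Variables (e : K) (op : 'Hom(D, 'End(D))).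
Variables (m1 : 'Hom(U, 'End(U))) (m2 : 'Hom(V, 'End(V))).
Variables (r1 : 'Hom(U, 'End(V))) (r2 : 'Hom(V, 'End(U))).
Hypothesis e2 : e * e = 1.
Hypothesis C : cross_op f g e op m1 m2 r1 r2.
Hypothesis m1E : even_bilin m1.
Hypothesis m2E : even_bilin m2.
Hypothesis r1E : even_bilin r1.
Hypothesis r2E : even_bilin r2.

Lemma cross_op_even : even_bilin op.
Proof.
move=> i j u v ui vj; rewrite -(inj_proj bp u) -(inj_proj bp v) !(homD, add_lfunE).
have pu := projl_even bp ui; have pv := projl_even bp vj.
have qu := projr_even bp ui; have qv := projr_even bp vj.
rewrite (cross_ll C) (cross_rr C) (cross_lr C pu qv) (cross_rl C pv qu).
have Hf := injl_even bp; have Hg := injr_even bp.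
have := Hg _ _ (r1E pv qu); rewrite addbC => gr1.
have := Hf _ _ (r2E qv pu); rewrite addbC => gr2.
rewrite !rpredD // ?rpredZ //; first [exact: Hf (m1E _ _)|exact: Hf (r2E _ _)
  |exact: Hg (m2E _ _)|exact: Hg (r1E _ _)].
Qed.

Hypothesis m1C : forall i j x y, x \in gr i -> y \in gr j ->
  m1 x y = (e * (-1) ^+ (i && j)) *: m1 y x.
Hypothesis m2C : forall i j x y, x \in gr i -> y \in gr j ->
  m2 x y = (e * (-1) ^+ (i && j)) *: m2 y x.

Lemma cross_opC i j (u v : D) : u \in gr i -> v \in gr j ->
  op u v = (e * (-1) ^+ (i && j)) *: op v u.
Proof.
move=> ui vj; rewrite -(inj_proj bp u) -(inj_proj bp v) !(homD, add_lfunE).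
have pu := projl_even bp ui; have pv := projl_even bp vj.
have qu := projr_even bp ui; have qv := projr_even bp vj.
have s2 : e * (-1) ^+ (i && j) * (e * (-1) ^+ (i && j)) = 1.
  by rewrite mulrACA e2 mul1r -signr_addb addbb.
rewrite !(cross_ll C) !(cross_rr C) (cross_lr C pu qv) (cross_rl C pv qu).
rewrite (cross_lr C pv qu) (cross_rl C pu qv) (m1C pu pv) (m2C qu qv) !homZ [j && i]andbC.
move: (e * _) s2 => s s2; vec_scalar; ring: s2.
Qed.
End CrossOperation.

(** * The invariant form *)

Section PairForm.
Variables (K : fieldType) (U V D : superVectType K).
Variables (b : 'Hom(U, dual V)) (b' : 'Hom(V, dual U)).
Hypothesis bb' : dual_pair b b'.
Variables (f : 'Hom(U, D)) (g : 'Hom(V, D)) (p : 'Hom(D, U)) (q : 'Hom(D, V)).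
Hypothesis bp : biproduct f g p q.
Variables (e : K) (op : 'Hom(D, 'End(D))).
Variables (m1 : 'Hom(U, 'End(U))) (m2 : 'Hom(V, 'End(V))).
Variables (r1 : 'Hom(U, 'End(V))) (r2 : 'Hom(V, 'End(U))).
Hypothesis e2 : e * e = 1.
Hypothesis m1E : even_bilin m1.
Hypothesis r1E : even_bilin r1.
Hypothesis m1C : forall i j x y, x \in gr i -> y \in gr j ->
  m1 x y = (e * (-1) ^+ (i && j)) *: m1 y x.
Hypothesis m2C : forall i j x y, x \in gr i -> y \in gr j ->
  m2 x y = (e * (-1) ^+ (i && j)) *: m2 y x.
Hypothesis r1_pair : forall i j x a y, x \in gr i -> a \in gr j ->
  b' (r1 x a) y = e * (-1) ^+ (i && j) * b' a (m1 x y).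
Hypothesis r2_pair : forall i j x a c, x \in gr i -> a \in gr j ->
  b (r2 a x) c = e * (-1) ^+ (i && j) * b x (m2 a c).

Let b'b := dual_pair_sym bb'.

Definition pair_form (u v : D) : K := b (p u) (q v) + b' (q u) (p v).

Lemma pair_formDl u u' v : pair_form (u + u') v = pair_form u v + pair_form u' v.
Proof. by rewrite /pair_form !(pairDl, homD) addrACA. Qed.
Lemma pair_formDr u v v' : pair_form u (v + v') = pair_form u v + pair_form u v'.
Proof. by rewrite /pair_form !(pairDr, homD) addrACA. Qed.

Let formE := (proj_injl bp, proj_injr bp, projl_injr bp, projr_injl bp).

Section Cross.
Hypothesis C : cross_op f g e op m1 m2 r1 r2.

(** As r1(y) is adjoint to m1(y), both sides are multiples of the pairing of [c] with m1(y, x). *)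
Lemma pair_form_llr i j k x y c : x \in gr i -> y \in gr j -> c \in gr k ->
  pair_form (op (f x) (f y)) (g c) = pair_form (f x) (op (f y) (g c)).
Proof.
move=> xi yj ck; rewrite (cross_ll C) (cross_lr C yj ck) /pair_form.
rewrite !(pairE, homD, homZ, formE) (m1C xi yj) pairE.
rewrite (pair_flip b'b (r1E yj ck) xi) (pair_flip b'b ck (m1E yj xi)) (r1_pair _ yj ck).
by case: (i) (j) (k) => -[] []; rewrite /= ?expr0 ?expr1; ring: e2.
Qed.

Lemma pair_form_lrl i k l x a z : x \in gr i -> a \in gr k -> z \in gr l ->
  pair_form (op (f x) (g a)) (f z) = pair_form (f x) (op (g a) (f z)).
Proof.
move=> xi ak zl; rewrite (cross_lr C xi ak) (cross_rl C zl ak) /pair_form.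
rewrite !(pairE, homD, homZ, formE) (r1_pair _ xi ak) (m1C xi zl) !pairE.
rewrite (pair_flip b'b (r1E zl ak) xi) (r1_pair _ zl ak).
by case: (i) (k) (l) => -[] []; rewrite /= ?expr0 ?expr1; ring: e2.
Qed.

Lemma pair_form_rll i k l x a z : x \in gr i -> a \in gr k -> z \in gr l ->
  pair_form (op (g a) (f x)) (f z) = pair_form (g a) (op (f x) (f z)).
Proof.
move=> xi ak zl; rewrite (cross_rl C xi ak) (cross_ll C) /pair_form.
rewrite !(pairE, homD, homZ, formE) (r1_pair _ xi ak).
by case: (i) (k) (l) => -[] []; rewrite /= ?expr0 ?expr1; ring: e2.
Qed.

End Cross.

(** Pairing with f(y) determines the [V]-component of op(f x)(g a): invariance, used twice, and
    commutativity reduce it to the pairing of [a] with m1(x, y), which determines r1(x)a. Pairing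
    with g(c) gives the [U]-component by one use of invariance. *)
Lemma cross_op_of_invariant :
  (forall x y, op (f x) (f y) = f (m1 x y)) ->
  (forall a c, op (g a) (g c) = g (m2 a c)) ->
  (forall i j u v, u \in gr i -> v \in gr j ->
    op u v = (e * (-1) ^+ (i && j)) *: op v u) ->
  (forall u v w, pair_form (op u v) w = pair_form u (op v w)) ->
  cross_op f g e op m1 m2 r1 r2.
Proof.
move=> ll rr opC inv.
have lr i j x a : x \in gr i -> a \in gr j ->
    op (f x) (g a) = g (r1 x a) + (e * (-1) ^+ (i && j)) *: f (r2 a x).
  move=> xi aj; rewrite -(inj_proj bp (op _ _)) addrC; congr (_ + _).
    congr (g _); apply: (pair_ext (dual_pair_sym bb')) => k y yk.
    have := inv (f x) (g a) (f y); rewrite (opC _ _ _ _ (injr_even bp aj) (injl_even bp yk)).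
    have := inv (f x) (f y) (g a); rewrite ll.
    rewrite /pair_form !(pairE, homZ, formE) !(addr0, add0r) (r1_pair _ xi aj).
    rewrite (pair_flip b'b aj (m1E xi yk)) => E0 ->.
    rewrite -E0.
    by case: (i) (j) (k) => -[] []; rewrite /= ?expr0 ?expr1; ring: e2.
  rewrite -homZ; congr (f _); apply: (pair_ext bb') => k c ck.
  have := inv (f x) (g a) (g c); rewrite rr /pair_form !(pairE, formE).
  rewrite (r2_pair _ xi aj) !addr0 => ->.
  by case: (i) (j) => -[]; rewrite /= ?expr0 ?expr1; ring: e2.
split=> // i j x a xi aj.
rewrite (opC _ _ _ _ (injr_even bp aj) (injl_even bp xi)) (lr _ _ _ _ xi aj) [j && i]andbC.
have s2 : e * (-1) ^+ (i && j) * (e * (-1) ^+ (i && j)) = 1.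
  by rewrite mulrACA e2 mul1r -signr_addb addbb.
by rewrite scalerDr scalerA s2 scale1r addrC.
Qed.

End PairForm.

Section InvariantForm.
Variables (K : fieldType) (U V D : superVectType K).
Variables (b : 'Hom(U, dual V)) (b' : 'Hom(V, dual U)).
Hypothesis bb' : dual_pair b b'.
Variables (f : 'Hom(U, D)) (g : 'Hom(V, D)) (p : 'Hom(D, U)) (q : 'Hom(D, V)).
Hypothesis bp : biproduct f g p q.
Variables (e : K) (op : 'Hom(D, 'End(D))).
Variables (m1 : 'Hom(U, 'End(U))) (m2 : 'Hom(V, 'End(V))).
Variables (r1 : 'Hom(U, 'End(V))) (r2 : 'Hom(V, 'End(U))).
Hypothesis e2 : e * e = 1.
Hypothesis C : cross_op f g e op m1 m2 r1 r2.
Hypothesis m1E : even_bilin m1.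
Hypothesis m2E : even_bilin m2.
Hypothesis r1E : even_bilin r1.
Hypothesis r2E : even_bilin r2.
Hypothesis m1C : forall i j x y, x \in gr i -> y \in gr j ->
  m1 x y = (e * (-1) ^+ (i && j)) *: m1 y x.
Hypothesis m2C : forall i j x y, x \in gr i -> y \in gr j ->
  m2 x y = (e * (-1) ^+ (i && j)) *: m2 y x.
Hypothesis r1_pair : forall i j x a y, x \in gr i -> a \in gr j ->
  b' (r1 x a) y = e * (-1) ^+ (i && j) * b' a (m1 x y).
Hypothesis r2_pair : forall i j x a c, x \in gr i -> a \in gr j ->
  b (r2 a x) c = e * (-1) ^+ (i && j) * b x (m2 a c).

Let r2_pair' i j a x c : a \in gr i -> x \in gr j ->
  b (r2 a x) c = e * (-1) ^+ (i && j) * b x (m2 a c).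
Proof. by move=> ai xj; rewrite (r2_pair _ xj ai) andbC. Qed.

Lemma pair_form_sym : pair_form b' b q p =2 pair_form b b' p q.
Proof. by move=> u v; rewrite /pair_form addrC. Qed.

(** Of the eight combinations of summands, the two pure ones vanish on both sides by isotropy, three
    are established above, and exchanging [U] and [V] gives the other three. *)
Lemma pair_form_invariant u v w :
  pair_form b b' p q (op u v) w = pair_form b b' p q u (op v w).
Proof.
have formE := (proj_injl bp, proj_injr bp, projl_injr bp, projr_injl bp).
have symE := pair_form_sym.
have b'b := dual_pair_sym bb'; have pb := biproduct_sym bp; have C' := cross_op_sym C.
have llr := pair_form_llr bb' bp e2 m1E r1E m1C r1_pair C.
have lrl := pair_form_lrl bb' bp e2 r1E m1C r1_pair C.
have rll := pair_form_rll b bp e2 r1_pair C.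
have rrl := pair_form_llr b'b pb e2 m2E r2E m2C r2_pair' C'.
have rlr := pair_form_lrl b'b pb e2 r2E m2C r2_pair' C'.
have lrr := pair_form_rll b' pb e2 r2_pair' C'.
move: u; apply: (hpart_ext (W := K)) => [u u'|u u'|i u ui].
- by rewrite !(homD, add_lfunE) pair_formDl.
- by rewrite pair_formDl.
move: v; apply: (hpart_ext (W := K)) => [v v'|v v'|j v vj].
- by rewrite !(homD, add_lfunE) pair_formDl.
- by rewrite !(homD, add_lfunE) pair_formDr.
move: w; apply: (hpart_ext (W := K)) => [w w'|w w'|k w wk].
- by rewrite pair_formDr.
- by rewrite !(homD, add_lfunE) pair_formDr.
move: u ui; apply: (biproduct_ext (W := K) bp) => [u u'|u u'|x xi|a ai].
- by rewrite !(homD, add_lfunE) pair_formDl.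
- by rewrite pair_formDl.
- move: v vj; apply: (biproduct_ext (W := K) bp) => [v v'|v v'|y yj|c cj].
  + by rewrite !(homD, add_lfunE) pair_formDl.
  + by rewrite !(homD, add_lfunE) pair_formDr.
  + move: w wk; apply: (biproduct_ext (W := K) bp) => [w w'|w w'|z zk|d dk].
    * by rewrite pair_formDr.
    * by rewrite !(homD, add_lfunE) pair_formDr.
    * by rewrite !(cross_ll C) /pair_form !formE !pairE.
    exact: llr xi yj dk.
  move: w wk; apply: (biproduct_ext (W := K) bp) => [w w'|w w'|z zk|d dk].
  + by rewrite pair_formDr.
  + by rewrite !(homD, add_lfunE) pair_formDr.
  + exact: lrl xi cj zk.
  by have := lrr _ _ _ _ _ _ cj xi dk; rewrite !symE.
move: v vj; apply: (biproduct_ext (W := K) bp) => [v v'|v v'|y yj|c cj].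
- by rewrite !(homD, add_lfunE) pair_formDl.
- by rewrite !(homD, add_lfunE) pair_formDr.
- move: w wk; apply: (biproduct_ext (W := K) bp) => [w w'|w w'|z zk|d dk].
  + by rewrite pair_formDr.
  + by rewrite !(homD, add_lfunE) pair_formDr.
  + exact: rll yj ai zk.
  by have := rlr _ _ _ _ _ _ ai yj dk; rewrite !symE.
move: w wk; apply: (biproduct_ext (W := K) bp) => [w w'|w w'|z zk|d dk].
- by rewrite pair_formDr.
- by rewrite !(homD, add_lfunE) pair_formDr.
- by have := rrl _ _ _ _ _ _ ai cj zk; rewrite !symE.
by rewrite !(cross_rr C) /pair_form !formE !pairE.
Qed.

End InvariantForm.

(** * Poisson axioms on the double *)

Section SupercommutativeAssociativity.
Variables (K : fieldType) (D : superVectType K) (mul : 'Hom(D, 'End(D))).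
Hypothesis mulE : even_bilin mul.
Hypothesis mulC : forall i j x y, x \in gr i -> y \in gr j ->
  mul x y = (-1) ^+ (i && j) *: mul y x.
Variables (i j k : bool) (x y z : D).
Hypotheses (xi : x \in gr i) (yj : y \in gr j) (zk : z \in gr k).

Lemma mul_assoc_rev :
  mul x (mul y z) = mul (mul x y) z -> mul z (mul y x) = mul (mul z y) x.
Proof.
move=> A; rewrite (mulC zk (mulE yj xi)) (mulC yj xi) (mulC (mulE zk yj) xi) (mulC zk yj).
rewrite !(homZ, scale_lfunE) -A.
by vec_scalar; case: (i) (j) (k) => -[] []; sign_ring.
Qed.

(** Together with reversal, this leaves associativity to be checked only when the factor from the
    other summand comes first. *)
Lemma mul_assoc_mid :
  mul x (mul y z) = mul (mul x y) z -> mul x (mul z y) = mul (mul x z) y ->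
  mul y (mul x z) = mul (mul y x) z.
Proof.
move=> A B; rewrite (mulC yj (mulE xi zk)) (mulC yj xi) !(homZ, scale_lfunE) -A -B.
rewrite (mulC zk yj) homZ.
by vec_scalar; case: (i) (j) (k) => -[] []; sign_ring.
Qed.
End SupercommutativeAssociativity.

Section PoissonDouble.
Variables (K : fieldType) (U V D : superVectType K).
Variables (f : 'Hom(U, D)) (g : 'Hom(V, D)) (p : 'Hom(D, U)) (q : 'Hom(D, V)).
Hypothesis bp : biproduct f g p q.
Variables (br1 mul1 : 'Hom(U, 'End(U))) (br2 mul2 : 'Hom(V, 'End(V))).
Variables (rho1 phi1 : 'Hom(U, 'End(V))) (rho2 phi2 : 'Hom(V, 'End(U))).
Variables (br mul : 'Hom(D, 'End(D))).
Hypothesis Cbr : cross_op f g (-1) br br1 br2 rho1 rho2.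
Hypothesis Cmul : cross_op f g 1 mul mul1 mul2 phi1 phi2.
Hypothesis PU : poisson_superalgebra br1 mul1.
Hypothesis PV : poisson_superalgebra br2 mul2.
Hypothesis mh1 : matched_pair_half br1 mul1 rho1 phi1 rho2 phi2.
Hypothesis mh2 : matched_pair_half br2 mul2 rho2 phi2 rho1 phi1.

Let rho1E := rho_even mh1.
Let phi1E := phi_even mh1.
Let rho2E := rho_even mh2.
Let phi2E := phi_even mh2.
Let pb := biproduct_sym bp.
Let Cbr' := cross_op_sym Cbr.
Let Cmul' := cross_op_sym Cmul.
Let fE := injl_even bp.
Let gE := injr_even bp.

Let mulE : even_bilin mul :=
  cross_op_even bp Cmul (mul_even PU) (mul_even PV) phi1E phi2E.

Let mulC i j (u v : D) : u \in gr i -> v \in gr j ->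
  mul u v = (-1) ^+ (i && j) *: mul v u.
Proof.
move=> ui vj; rewrite -[(-1) ^+ _]mul1r; apply: (cross_opC bp _ Cmul _ _ ui vj).
- exact: mul1r.
- by move=> k l x y xk yl; rewrite mul1r; exact: (mul_comm PU).
by move=> k l x y xk yl; rewrite mul1r; exact: (mul_comm PV).
Qed.

Let brC i j (u v : D) : u \in gr i -> v \in gr j ->
  br u v = - ((-1) ^+ (i && j) *: br v u).
Proof.
move=> ui vj; rewrite -scaleNr -mulN1r; apply: (cross_opC bp _ Cbr _ _ ui vj).
- by rewrite mulrNN mul1r.
- by move=> k l x y xk yl; rewrite mulN1r scaleNr; exact: (br_skew PU).
by move=> k l x y xk yl; rewrite mulN1r scaleNr; exact: (br_skew PV).
Qed.

Let J i j k (u v w : D) :=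
  (-1) ^+ (i && k) *: br u (br v w) + (-1) ^+ (k && j) *: br w (br u v)
  + (-1) ^+ (j && i) *: br v (br w u).

(** Cyclic symmetry brings every argument to the first place, where additivity is available, and
    leaves four types of triples to check. *)
Let J_cycle i j k u v w : J i j k u v w = J j k i v w u.
Proof. by rewrite /J [in LHS]addrC addrA. Qed.

Let JD1 i j k v w : {morph (fun u => J i j k u v w) : u u' / u + u'}.
Proof.
move=> u u'; rewrite /J; move: ((-1) ^+ _) ((-1) ^+ _) ((-1) ^+ _) => s1 s2 s3.
by vec_scalar; ring.
Qed.

Let zeroD : {morph (fun _ : D => 0 : D) : u u' / u + u'}.
Proof. by move=> u u'; rewrite addr0. Qed.

Let J_pure_lll i j k x y z : x \in gr i -> y \in gr j -> z \in gr k ->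
  J i j k (f x) (f y) (f z) = 0.
Proof.
move=> xi yj zk; rewrite /J !(cross_ll Cbr).
by have := congr1 f (br_jacobi PU xi yj zk); rewrite !(homD, homZ) hom0.
Qed.

Let J_pure_rrr i j k x y z : x \in gr i -> y \in gr j -> z \in gr k ->
  J i j k (g x) (g y) (g z) = 0.
Proof.
move=> xi yj zk; rewrite /J !(cross_rr Cbr).
by have := congr1 g (br_jacobi PV xi yj zk); rewrite !(homD, homZ) hom0.
Qed.

Let J_pure_llr i j k x y a : x \in gr i -> y \in gr j -> a \in gr k ->
  J i j k (f x) (f y) (g a) = 0.
Proof. by move=> xi yj ak; exact: (cross_jacobi Cbr PU rho1E rho2E xi yj ak mh1). Qed.

Let J_pure_rrl i j k a c x : a \in gr i -> c \in gr j -> x \in gr k ->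
  J i j k (g a) (g c) (f x) = 0.
Proof. by move=> ai cj xk; exact: (cross_jacobi Cbr' PV rho2E rho1E ai cj xk mh2). Qed.

Lemma double_jacobi i j k (u v w : D) : u \in gr i -> v \in gr j -> w \in gr k ->
  J i j k u v w = 0.
Proof.
move=> ui vj wk; move: u ui; apply: (biproduct_ext bp (JD1 _ _ _ _ _) zeroD) => [x xi|a ai];
  rewrite J_cycle; move: v vj; apply: (biproduct_ext bp (JD1 _ _ _ _ _) zeroD) => [y yj|c cj];
  rewrite J_cycle; move: w wk; apply: (biproduct_ext bp (JD1 _ _ _ _ _) zeroD) => [z zk|d dk];
  rewrite J_cycle.
- exact: J_pure_lll.
- exact: J_pure_llr.
- by rewrite -J_cycle; exact: J_pure_llr.
- by rewrite J_cycle; exact: J_pure_rrl.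
- by rewrite J_cycle; exact: J_pure_llr.
- by rewrite -J_cycle; exact: J_pure_rrl.
- exact: J_pure_rrl.
exact: J_pure_rrr.
Qed.

Let assoc_rll i j k x y a : x \in gr i -> y \in gr j -> a \in gr k ->
  mul (g a) (mul (f x) (f y)) = mul (mul (g a) (f x)) (f y).
Proof. by move=> xi yj ak; exact: (cross_assoc_rll Cmul PU phi1E xi yj ak mh1). Qed.

Let assoc_lrr i j k x y a : x \in gr i -> y \in gr j -> a \in gr k ->
  mul (f a) (mul (g x) (g y)) = mul (mul (f a) (g x)) (g y).
Proof. by move=> xi yj ak; exact: (cross_assoc_rll Cmul' PV phi2E xi yj ak mh2). Qed.

Lemma double_assoc (u v w : D) : mul u (mul v w) = mul (mul u v) w.
Proof.
move: u v w; have D1 v w : {morph (fun u => mul u (mul v w)) : u u' / u + u'}.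
  by move=> u u'; rewrite !(homD, add_lfunE).
have D1' v w : {morph (fun u => mul (mul u v) w) : u u' / u + u'}.
  by move=> u u'; rewrite !(homD, add_lfunE).
have D2 u w : {morph (fun v => mul u (mul v w)) : u u' / u + u'}.
  by move=> v v'; rewrite !(homD, add_lfunE).
have D2' u w : {morph (fun v => mul (mul u v) w) : u u' / u + u'}.
  by move=> v v'; rewrite !(homD, add_lfunE).
have D3 u v : {morph (fun w => mul u (mul v w)) : u u' / u + u'}.
  by move=> w w'; rewrite !homD.
have D3' u v : {morph (fun w => mul (mul u v) w) : u u' / u + u'}.
  by move=> w w'; rewrite !homD.
move=> u v w; move: u; apply: (hpart_ext (D1 _ _) (D1' _ _)) => i u ui.
move: v; apply: (hpart_ext (D2 _ _) (D2' _ _)) => j v vj.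
move: w; apply: (hpart_ext (D3 _ _) (D3' _ _)) => k w wk.
move: u ui; apply: (biproduct_ext bp (D1 _ _) (D1' _ _)) => [x xi|a ai];
  move: v vj; apply: (biproduct_ext bp (D2 _ _) (D2' _ _)) => [y yj|c cj];
  move: w wk; apply: (biproduct_ext bp (D3 _ _) (D3' _ _)) => [z zk|d dk].
- by rewrite !(cross_ll Cmul) (mul_assoc PU).
- apply: (mul_assoc_rev mulE mulC (gE dk) (fE yj) (fE xi)); exact: assoc_rll yj xi dk.
- apply: (mul_assoc_mid mulE mulC (gE cj) (fE xi) (fE zk)).
    exact: assoc_rll xi zk cj.
  exact: assoc_rll zk xi cj.
- exact: assoc_lrr cj dk xi.
- exact: assoc_rll yj zk ai.
- apply: (mul_assoc_mid mulE mulC (fE yj) (gE ai) (gE dk)).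
    exact: assoc_lrr ai dk yj.
  exact: assoc_lrr dk ai yj.
- apply: (mul_assoc_rev mulE mulC (fE zk) (gE cj) (gE ai)); exact: assoc_lrr cj ai zk.
by rewrite !(cross_rr Cmul) (mul_assoc PV).
Qed.

Lemma double_leibniz i j (u v w : D) : u \in gr i -> v \in gr j ->
  br u (mul v w) = mul (br u v) w + (-1) ^+ (i && j) *: mul v (br u w).
Proof.
move: u v w; have D1 v w : {morph (fun u => br u (mul v w)) : u u' / u + u'}.
  by move=> u u'; rewrite !(homD, add_lfunE).
have D1' s v w : {morph (fun u => mul (br u v) w + s *: mul v (br u w)) : u u' / u + u'}.
  by move=> u u'; rewrite !(homD, add_lfunE) scalerDr addrACA.
have D2 u w : {morph (fun v => br u (mul v w)) : u u' / u + u'}.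
  by move=> v v'; rewrite !(homD, add_lfunE).
have D2' s u w : {morph (fun v => mul (br u v) w + s *: mul v (br u w)) : u u' / u + u'}.
  by move=> v v'; rewrite !(homD, add_lfunE) scalerDr addrACA.
have D3 u v : {morph (fun w => br u (mul v w)) : u u' / u + u'}.
  by move=> w w'; rewrite !homD.
have D3' s u v : {morph (fun w => mul (br u v) w + s *: mul v (br u w)) : u u' / u + u'}.
  by move=> w w'; rewrite !homD scalerDr addrACA.
move=> u v w ui vj; move: w; apply: (hpart_ext (D3 _ _) (D3' _ _ _)) => k w wk.
move: u ui; apply: (biproduct_ext bp (D1 _ _) (D1' _ _ _)) => [x xi|a ai];
  move: v vj; apply: (biproduct_ext bp (D2 _ _) (D2' _ _ _)) => [y yj|c cj];
  move: w wk; apply: (biproduct_ext bp (D3 _ _) (D3' _ _ _)) => [z zk|d dk].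
- by rewrite !(cross_ll Cmul, cross_ll Cbr) (br_leibniz PU _ xi yj) homD homZ.
- exact: (cross_leibniz_llr Cbr Cmul PU rho1E phi1E rho2E xi yj dk mh1).
- exact: (cross_leibniz_lrl Cbr Cmul PU rho1E phi1E xi zk cj mh1).
- exact: (cross_leibniz_rll Cbr' Cmul' PV rho2E cj dk xi mh2).
- exact: (cross_leibniz_rll Cbr Cmul PU rho1E yj zk ai mh1).
- exact: (cross_leibniz_lrl Cbr' Cmul' PV rho2E phi2E ai dk yj mh2).
- exact: (cross_leibniz_llr Cbr' Cmul' PV rho2E phi2E rho1E ai cj zk mh2).
by rewrite !(cross_rr Cmul, cross_rr Cbr) (br_leibniz PV _ ai cj) homD homZ.
Qed.

Lemma double_poisson : poisson_superalgebra br mul.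
Proof.
split=> //.
- exact: (cross_op_even bp Cbr (br_even PU) (br_even PV) rho1E rho2E).
- exact: double_jacobi.
- exact: double_assoc.
exact: double_leibniz.
Qed.

End PoissonDouble.

(** * The double on the product space *)

Section ProductBiproduct.
Variables (K : fieldType) (U V : superVectType K).
Local Notation D := (U * V)%type.

Definition fst_lfun : 'Hom(D, U) := linfun fst.
Definition snd_lfun : 'Hom(D, V) := linfun snd.

Lemma fst_lfunE w : fst_lfun w = w.1.
Proof. exact: linfunE. Qed.

Lemma snd_lfunE w : snd_lfun w = w.2.
Proof. exact: linfunE. Qed.

Lemma pair_biproduct : biproduct (inl_lfun U V) (inr_lfun U V) fst_lfun snd_lfun.
Proof.
split=> [x|a|a|x|[x a]|i x xi|i a ai|i w|i w];
  rewrite ?(fst_lfunE, snd_lfunE, inl_lfunE, inr_lfunE) //.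
- by congr (_, _); rewrite /= ?addr0 ?add0r.
- by rewrite /gr /= pair_grP /= xi mem0v.
- by rewrite /gr /= pair_grP /= ai mem0v.
- by rewrite {1}/gr /= pair_grP => /andP[].
by rewrite {1}/gr /= pair_grP => /andP[].
Qed.

(** The sign depends on parities, so a linear map defined on all vectors has to go through
    homogeneous parts. *)
Definition koszul_flip (W : vectType K) (r : 'Hom(V, 'Hom(U, W))) : 'Hom(U, 'Hom(V, W)) :=
  linfun (fun u => linfun (fun v =>
    \sum_i \sum_j (-1) ^+ (i && j) *: r (hpart j v) (hpart i u))).

Lemma koszul_flipE (W : vectType K) (r : 'Hom(V, 'Hom(U, W))) i j u v :
  u \in gr i -> v \in gr j -> koszul_flip r u v = (-1) ^+ (i && j) *: r v u.
Proof.
move=> ui vj.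
have B (c : K) : bilin (fun u v => c *: r v u).
  by split=> [w d x y|w d x y] /=; vec_scalar; ring.
have FB i' j' : bilin ((fun i j u v => (-1) ^+ (i && j) *: r v u) i' j') := B _.
by rewrite /koszul_flip (linfun2E (bilin_hsum FB)) (hsumE FB ui vj).
Qed.

End ProductBiproduct.

Section ProductOperation.
Variables (K : fieldType) (U V : superVectType K) (e : K).
Variables (m1 : 'Hom(U, 'End(U))) (m2 : 'Hom(V, 'End(V))).
Variables (r1 : 'Hom(U, 'End(V))) (r2 : 'Hom(V, 'End(U))).
Local Notation D := (U * V)%type.

Definition double_op : 'Hom(D, 'End(D)) := linfun (fun w => linfun (fun w' : D =>
  (m1 w.1 w'.1 + r2 w.2 w'.1 + e *: koszul_flip r2 w.1 w'.2,
   m2 w.2 w'.2 + r1 w.1 w'.2 + e *: koszul_flip r1 w.2 w'.1))).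

Lemma double_opE w w' : double_op w w' =
  (m1 w.1 w'.1 + r2 w.2 w'.1 + e *: koszul_flip r2 w.1 w'.2,
   m2 w.2 w'.2 + r1 w.1 w'.2 + e *: koszul_flip r1 w.2 w'.1).
Proof.
rewrite /double_op linfun2E //.
by split=> [v c u u'|u c v v'] /=; congr (_, _); rewrite /=; vec_scalar; ring.
Qed.

Lemma double_op_cross :
  cross_op (inl_lfun U V) (inr_lfun U V) e double_op m1 m2 r1 r2.
Proof.
split=> [x y|a c|i j x a xi aj|i j x a xi aj];
  rewrite !(inl_lfunE, inr_lfunE) double_opE /=.
- by rewrite !(hom0, zero_lfunE, scaler0, addr0).
- by rewrite !(hom0, zero_lfunE, scaler0, addr0, add0r).
- rewrite !(hom0, zero_lfunE, scaler0, addr0, add0r) (koszul_flipE _ xi aj) scalerA.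
  by congr (_, _); rewrite /= ?scaler0 ?addr0 ?add0r.
rewrite !(hom0, zero_lfunE, scaler0, addr0, add0r) (koszul_flipE _ aj xi) scalerA andbC.
by congr (_, _); rewrite /= ?scaler0 ?addr0 ?add0r.
Qed.

End ProductOperation.

(** * Matched pairs and doubles *)

Section HalfOfDouble.
Variables (K : fieldType) (U V D : superVectType K).
Variables (b : 'Hom(U, dual V)) (b' : 'Hom(V, dual U)).
Hypothesis bb' : dual_pair b b'.
Variables (f : 'Hom(U, D)) (g : 'Hom(V, D)) (p : 'Hom(D, U)) (q : 'Hom(D, V)).
Hypothesis bp : biproduct f g p q.
Variables (br1 mul1 : 'Hom(U, 'End(U))) (br2 mul2 : 'Hom(V, 'End(V))).
Variables (br mul : 'Hom(D, 'End(D))).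
Hypothesis PU : poisson_superalgebra br1 mul1.
Hypothesis PV : poisson_superalgebra br2 mul2.
Hypothesis PD : poisson_superalgebra br mul.
Let rho1 := coadj b' br1.
Let phi1 := - coadj b' mul1.
Let rho2 := coadj b br2.
Let phi2 := - coadj b mul2.
Hypothesis Cbr : cross_op f g (-1) br br1 br2 rho1 rho2.
Hypothesis Cmul : cross_op f g 1 mul mul1 mul2 phi1 phi2.

(** Evenness and (R) come from the coadjoint maps themselves, (M1), (M2) and (M3) from the
    double. *)
Lemma matched_half_of_double : matched_pair_half br1 mul1 rho1 phi1 rho2 phi2.
Proof.
have rho1E : even_bilin rho1 := coadj_even bb' (br_even PU).
have phi1E : even_bilin phi1 := coadj_phi_even bb' PU.
have rho2E : even_bilin rho2 := coadj_even (dual_pair_sym bb') (br_even PV).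
have phi2E : even_bilin phi2 := coadj_phi_even (dual_pair_sym bb') PV.
split=> //.
- exact: (coadj_rho_br bb' PU).
- exact: (coadj_phi_mul bb' PU).
- exact: (coadj_rho_mul bb' PU).
- exact: (coadj_phi_br bb' PU).
- move=> i j k x y a xi yj ak; exact: (cross_matched_br bp Cbr PU rho1E xi yj ak PD).
(* (M2) allows arbitrary [y], while components are compared for homogeneous vectors. *)
- move=> i k x y a xi ak; move: y; apply: hpart_ext => [y y'|y y'|j y yj].
  + by rewrite !homD.
  + by rewrite !homD scalerDr addrACA.
  exact: (cross_matched_mul bp Cmul PU phi1E xi yj ak PD).
- move=> i j k x y a xi yj ak.
  exact: (cross_matched_leibniz1 bp Cbr Cmul PU rho1E xi yj ak PD).
move=> i j k x y a xi yj ak.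
exact: (cross_matched_leibniz2 bp Cbr Cmul PU rho1E phi1E xi yj ak PD).
Qed.

End HalfOfDouble.

Section CoadjointPairing.
Variables (K : fieldType) (U V : superVectType K).
Variables (b : 'Hom(U, dual V)) (b' : 'Hom(V, dual U)).
Hypothesis bb' : dual_pair b b'.
Variables (m : 'Hom(U, 'End(U))).

Lemma coadj_pair i j x a y : x \in gr i -> a \in gr j ->
  b' (coadj b' m x a) y = -1 * (-1) ^+ (i && j) * b' a (m x y).
Proof.
move=> xi aj; rewrite (coadjE (pair_perfectr bb') _ _ xi aj); ring.
Qed.

Lemma Ncoadj_pair i j x a y : x \in gr i -> a \in gr j ->
  b' ((- coadj b' m) x a) y = 1 * (-1) ^+ (i && j) * b' a (m x y).
Proof.
move=> xi aj; rewrite !opp_lfunE pairNl (coadj_pair _ xi aj); ring.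
Qed.

End CoadjointPairing.

Section SignedCommutativity.
Variables (K : fieldType) (P : superVectType K) (br mul : 'Hom(P, 'End(P))).
Hypothesis PA : poisson_superalgebra br mul.

Lemma br_skewZ i j (x y : P) : x \in gr i -> y \in gr j ->
  br x y = (-1 * (-1) ^+ (i && j)) *: br y x.
Proof. by move=> xi yj; rewrite mulN1r scaleNr; exact: (br_skew PA). Qed.

Lemma mul_commZ i j (x y : P) : x \in gr i -> y \in gr j ->
  mul x y = (1 * (-1) ^+ (i && j)) *: mul y x.
Proof. by move=> xi yj; rewrite mul1r; exact: (mul_comm PA). Qed.

End SignedCommutativity.

Section DoubleMatched.
Variables (K : fieldType) (U V D : superVectType K).
Variables (b : 'Hom(U, dual V)) (b' : 'Hom(V, dual U)).
Hypothesis bb' : dual_pair b b'.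
Variables (f : 'Hom(U, D)) (g : 'Hom(V, D)) (p : 'Hom(D, U)) (q : 'Hom(D, V)).
Hypothesis bp : biproduct f g p q.
Variables (br1 mul1 : 'Hom(U, 'End(U))) (br2 mul2 : 'Hom(V, 'End(V))).
Variables (br mul : 'Hom(D, 'End(D))).
Hypothesis PU : poisson_superalgebra br1 mul1.
Hypothesis PV : poisson_superalgebra br2 mul2.
Let rho1 := coadj b' br1.
Let phi1 := - coadj b' mul1.
Let rho2 := coadj b br2.
Let phi2 := - coadj b mul2.
Let b'b := dual_pair_sym bb'.

Let N1sq : -1 * -1 = 1 :> K. Proof. by rewrite mulrNN mul1r. Qed.
Let rho1_pair := coadj_pair bb' br1.
Let phi1_pair := Ncoadj_pair bb' mul1.
Let rho2_pair i j x a c : x \in gr i -> a \in gr j ->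
  b (rho2 a x) c = -1 * (-1) ^+ (i && j) * b x (br2 a c).
Proof. by move=> xi aj; rewrite (coadj_pair b'b _ _ aj xi) andbC. Qed.
Let phi2_pair i j x a c : x \in gr i -> a \in gr j ->
  b (phi2 a x) c = 1 * (-1) ^+ (i && j) * b x (mul2 a c).
Proof. by move=> xi aj; rewrite (Ncoadj_pair b'b _ _ aj xi) andbC. Qed.
Let rho1E : even_bilin rho1 := coadj_even bb' (br_even PU).
Let phi1E : even_bilin phi1 := coadj_phi_even bb' PU.
Let rho2E : even_bilin rho2 := coadj_even b'b (br_even PV).
Let phi2E : even_bilin phi2 := coadj_phi_even b'b PV.

Lemma double_of_matched_pair :
  cross_op f g (-1) br br1 br2 rho1 rho2 ->
  cross_op f g 1 mul mul1 mul2 phi1 phi2 ->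
  matched_pair br1 mul1 br2 mul2 rho1 phi1 rho2 phi2 ->
  [/\ poisson_superalgebra br mul, poisson_embedding br1 mul1 br mul f,
      poisson_embedding br2 mul2 br mul g
    & invariant_form br mul (pair_form b b' p q)].
Proof.
move=> Cbr Cmul [_ _ mh1 mh2]; split.
- exact: (double_poisson bp Cbr Cmul PU PV mh1 mh2).
- by split=> x y; [exact: (cross_ll Cbr)|exact: (cross_ll Cmul)].
- by split=> x y; [exact: (cross_rr Cbr)|exact: (cross_rr Cmul)].
split.
  exact: (pair_form_invariant bb' bp N1sq Cbr (br_even PU) (br_even PV) rho1E rho2E
    (br_skewZ PU) (br_skewZ PV) rho1_pair rho2_pair).
exact: (pair_form_invariant bb' bp (mulr1 1) Cmul (mul_even PU) (mul_even PV) phi1E phi2E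
  (mul_commZ PU) (mul_commZ PV) phi1_pair phi2_pair).
Qed.

Lemma matched_pair_of_double :
  poisson_superalgebra br mul -> poisson_embedding br1 mul1 br mul f ->
  poisson_embedding br2 mul2 br mul g -> invariant_form br mul (pair_form b b' p q) ->
  matched_pair br1 mul1 br2 mul2 rho1 phi1 rho2 phi2.
Proof.
move=> PD [brl mull] [brr mulr] [br_inv mul_inv].
have Cbr : cross_op f g (-1) br br1 br2 rho1 rho2.
  exact: (cross_op_of_invariant bb' bp N1sq (br_even PU)
    rho1_pair rho2_pair brl brr (br_skewZ PD)).
have Cmul : cross_op f g 1 mul mul1 mul2 phi1 phi2.
  exact: (cross_op_of_invariant bb' bp (mulr1 1) (mul_even PU)
    phi1_pair phi2_pair mull mulr (mul_commZ PD)).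
split=> //; first exact: (matched_half_of_double bb' bp PU PV PD Cbr Cmul).
exact: (matched_half_of_double b'b (biproduct_sym bp) PV PU PD
  (cross_op_sym Cbr) (cross_op_sym Cmul)).
Qed.

End DoubleMatched.

(** * The Manin form and the equivalence *)

Lemma manin_formE (K : fieldType) (P : superVectType K) :
  pair_form (bpair P) (dpair P) (fst_lfun P (dual P)) (snd_lfun P (dual P)) =2
  @manin_form K P.
Proof. by move=> u v; rewrite /pair_form !(fst_lfunE, snd_lfunE). Qed.

Lemma manin_form_isotropic (K : fieldType) (P : superVectType K) :
  isotropic (@manin_form K P) (limg (inl_lfun P (dual P))) /\
  isotropic (@manin_form K P) (limg (inr_lfun P (dual P))).
Proof.
split=> u v /memv_imgP[x _ ->] /memv_imgP[y _ ->];
  by rewrite /manin_form ?inl_lfunE ?inr_lfunE !(pair0l, pair0r) addr0.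
Qed.

Lemma eq_invariant_form (K : fieldType) (D : superVectType K)
    (br mul : 'Hom(D, 'End(D))) (B B' : D -> D -> K) :
  B =2 B' -> invariant_form br mul B -> invariant_form br mul B'.
Proof. by move=> BB' [H1 H2]; split=> u v w; rewrite -!BB'. Qed.

Theorem theorem4p2 (K : fieldType) (char0 : [pchar K] =i pred0)
    (P : superVectType K) (br1 mul1 : 'Hom(P, 'End(P)))
    (delta Delta : 'Hom(P, tensor P P))
    (P_poisson : poisson_superalgebra br1 mul1)
    (delta_even : even_map delta) (Delta_even : even_map Delta) :
  let br2 : 'Hom(dual P, 'End(dual P)) := dual_mul (bpair P) delta in
  let mul2 : 'Hom(dual P, 'End(dual P)) := dual_mul (bpair P) Delta in
  let delta' : 'Hom(dual P, tensor (dual P) (dual P)) :=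
    dual_comul (dpair P) br1 in
  let Delta' : 'Hom(dual P, tensor (dual P) (dual P)) :=
    dual_comul (dpair P) mul1 in
  poisson_superalgebra br2 mul2 ->
  [<-> poisson_superbialgebra br1 mul1 delta Delta /\
       poisson_superbialgebra br2 mul2 delta' Delta';
       matched_pair br1 mul1 br2 mul2
         (coadj (dpair P) br1) (- coadj (dpair P) mul1)
         (coadj (bpair P) br2) (- coadj (bpair P) mul2);
       standard_manin_triple br1 mul1 br2 mul2].
Proof.
move=> br2 mul2 delta' Delta' P2.
have bb' := bpair_dpair P; have b'b := dual_pair_sym bb'.
have bp := pair_biproduct P (dual P).
have dual1 (d : 'Hom(P, tensor P P)) u v w :
    bpair P u (dual_mul (bpair P) d v w) = tpair (bpair P) (d u) (v \ox w).
  exact: (dual_mulE (bpair_perfect P)).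
(* The same duality with the roles exchanged: the operations now live on P and the comultiplications
   on its dual. *)
have dual2 (m : 'Hom(P, 'End(P))) u v w :
    dpair P u (m v w) = tpair (dpair P) (dual_comul (dpair P) m u) (v \ox w).
  by rewrite (dual_comulE (dpair_perfect P)).
tfae=> [[bi1 bi2]||].
- split=> //.
    exact: (matched_half_of_bialgebra bb' P_poisson P2 (dual1 _) (dual1 _) bi1).
  exact: (matched_half_of_bialgebra b'b P2 P_poisson (dual2 _) (dual2 _) bi2).
- have Cbr := double_op_cross (-1) br1 br2 (coadj (dpair P) br1) (coadj (bpair P) br2).
  have Cmul := double_op_cross 1 mul1 mul2 (- coadj (dpair P) mul1) (- coadj (bpair P) mul2).
  move=> /(double_of_matched_pair bb' bp P_poisson P2 Cbr Cmul)[PD El Er inv].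
  exists (double_op (-1) br1 br2 (coadj (dpair P) br1) (coadj (bpair P) br2)).
  exists (double_op 1 mul1 mul2 (- coadj (dpair P) mul1) (- coadj (bpair P) mul2)).
  split=> //; first exact: manin_form_isotropic.
  exact: eq_invariant_form (@manin_formE _ P) inv.
case=> br [mul [PD El Er _ /(eq_invariant_form (fun u v => esym (@manin_formE _ P u v))) inv]].
have [_ _ mh1 mh2] := matched_pair_of_double bb' bp P_poisson P2 PD El Er inv.
split.
  exact: (bialgebra_of_matched_half bb' P_poisson P2 (dual1 _) (dual1 _) mh1).
exact: (bialgebra_of_matched_half b'b P2 P_poisson (dual2 _) (dual2 _) mh2).
Qed.
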